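(* There is an algorithm that solves Returning BudgetedDelivery on trees in time $\mathcal{O}(n + k\log k)$, where $n$ is the number of vertices of the tree and $k$ is the number of agents.
   Context: BudgetedDelivery: we are given an undirected graph $G=(V,E)$ with $n=|V|$ vertices and $m=|E|$ edges, non-negative edge weights $w(e)$ (the energy needed to traverse edge $e$ in either direction; traversing a fraction of an edge costs the corresponding fraction of its weight), two vertices $s\neq t$, and $k$ mobile agents, agent $i$ starting at vertex $p_i$ with an energy budget $B_i\in\mathbb{R}_{\ge 0}$, i.e. agent $i$ may move along the edges for a total distance of at most $B_i$. A message is initially at $s$. An agent can pick up the message at its current location, carry it, and drop it at any location (a vertex or a point inside an edge), where another agent may later pick it up. A schedule specifies for each agent whether it moves and, if so, where it picks up and drops off the message; it is feasible if the message is delivered from $s$ to $t$ and no agent travels more than its budget. In the Returning version, additionally each agent must end at its own starting position $p_i$ (the return trip counts towards its budget); in the Non-Returning version agents may stop anywhere. The decision problem asks whether a feasible schedule exists. *)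

(* Defs.v *)
From HB Require Import structures.
From mathcomp Require Import all_boot all_order all_algebra.
From mathcomp Require Import reals.

Set Implicit Arguments.
Unset Strict Implicit.
Unset Printing Implicit Defensive.

Import Order.TTheory GRing.Theory Num.Theory.
Local Open Scope ring_scope.

(* The graph is given by its edge list; (u, v, c) is the undirected edge
   {u, v} of weight c, listed once in either orientation (see [valid]). *)
Record instance (R : realType) := Instance {
  nv : nat;
  edges : seq ('I_nv * 'I_nv * R);
  src : 'I_nv;
  dst : 'I_nv;
  nag : nat;
  pos : 'I_nag -> 'I_nv;
  budget : 'I_nag -> R
}.

Definition adj (R : realType) (I : instance R) : rel 'I_(nv I) :=
  fun u v => has (fun e => (e.1 == (u, v)) || (e.1 == (v, u))) (edges I).

Definition valid (R : realType) (I : instance R) : Prop :=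
  [/\ forall u v c, (u, v, c) \in edges I -> u != v /\ 0 <= c,
      uniq [seq [set e.1.1; e.1.2] | e <- edges I],
      src I != dst I
    & forall i, 0 <= @budget R I i].

Definition is_tree (R : realType) (I : instance R) : Prop :=
  (forall u v : 'I_(nv I), connect (@adj R I) u v) /\
  (forall c : seq 'I_(nv I), (2 < size c)%N -> ~~ ucycleb (@adj R I) c).

(* Locations are points of the geometric realization of the graph, in
   barycentric coordinates.  Hence [on_edge u v a] and [on_edge v u (1 - a)]
   are equal, as are [on_edge u v 0] and [at_vertex u]. *)
Definition location (R : realType) (I : instance R) := {ffun 'I_(nv I) -> R}.

Definition at_vertex (R : realType) (I : instance R) (u : 'I_(nv I)) :
    location I :=
  [ffun x => (x == u)%:R].

Definition on_edge (R : realType) (I : instance R) (u v : 'I_(nv I)) (a : R) :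
    location I :=
  [ffun x => (1 - a) * (x == u)%:R + a * (x == v)%:R].

(* [walk x y l]: one can move from x to y, travelling a total distance l. *)
Inductive walk (R : realType) (I : instance R) :
    location I -> location I -> R -> Prop :=
| walk_stay x : walk x x 0
| walk_along u v c a b y l :
    (u, v, c) \in edges I -> 0 <= a <= 1 -> 0 <= b <= 1 ->
    walk (on_edge u v b) y l ->
    walk (on_edge u v a) y (`|a - b| * c + l).

(* [None]: the agent does not move;
   [Some (q, r)]: it picks the message up at q and drops it at r. *)
Definition schedule (R : realType) (I : instance R) :=
  'I_(nag I) -> option (location I * location I).

(* The agents of [o], one after the other, bring the message from x to y. *)
Fixpoint relay (R : realType) (I : instance R) (S : schedule I)
    (o : seq 'I_(nag I)) (x y : location I) : Prop :=
  if o is i :: o' then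
    exists2 z, S i = Some (x, z) & relay S o' z y
  else x = y.

Definition delivers (R : realType) (I : instance R) (S : schedule I) : Prop :=
  exists o : seq 'I_(nag I),
    [/\ uniq o, forall i, (i \in o) = isSome (S i)
      & relay S o (at_vertex (src I)) (at_vertex (dst I))].

Definition returning_within_budget (R : realType) (I : instance R)
    (S : schedule I) : Prop :=
  forall i q r, S i = Some (q, r) ->
    exists l1 l2 l3 : R,
      [/\ walk (at_vertex (pos i)) q l1,
          walk q r l2,
          walk r (at_vertex (pos i)) l3
        & l1 + l2 + l3 <= budget i].

Definition returning_delivery (R : realType) (I : instance R) : Prop :=
  exists S : schedule I, delivers S /\ returning_within_budget S.

(* Structured programs for a real RAM.  The memory has arrays of natural
   numbers and arrays of reals, indirectly addressable; a program names
   finitely many of them.  Every elementary operation has unit cost.  Naturals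
   can only be added, subtracted (truncated) and compared, and so can reals;
   in particular there is no rounding and no conversion between the two. *)
Inductive nexp : Type :=
| NNum of nat
| NGet of nat & nexp
| NAdd of nexp & nexp
| NSub of nexp & nexp.

Inductive rexp : Type :=
| RGet of nat & nexp
| RAdd of rexp & rexp
| RSub of rexp & rexp.

Inductive bexp : Type :=
| BLeN of nexp & nexp
| BLeR of rexp & rexp
| BNot of bexp
| BAnd of bexp & bexp.

Inductive cmd : Type :=
| Skip
| NSet of nat & nexp & nexp
| RSet of nat & nexp & rexp
| Seq of cmd & cmd
| If of bexp & cmd & cmd
| While of bexp & cmd.

(* First argument: name of the array; second argument: index. *)
Record state (R : realType) := State {
  nmem : nat -> nat -> nat;
  rmem : nat -> nat -> R
}.

Definition upd (A : Type) (f : nat -> nat -> A) (a i : nat) (x : A) :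
    nat -> nat -> A :=
  fun b j => if (b == a) && (j == i) then x else f b j.

Fixpoint neval (R : realType) (st : state R) (e : nexp) : nat :=
  match e with
  | NNum n => n
  | NGet a i => nmem st a (neval st i)
  | NAdd e1 e2 => (neval st e1 + neval st e2)%N
  | NSub e1 e2 => (neval st e1 - neval st e2)%N
  end.

Fixpoint reval (R : realType) (st : state R) (e : rexp) : R :=
  match e with
  | RGet a i => rmem st a (neval st i)
  | RAdd e1 e2 => reval st e1 + reval st e2
  | RSub e1 e2 => reval st e1 - reval st e2
  end.

Fixpoint beval (R : realType) (st : state R) (e : bexp) : bool :=
  match e with
  | BLeN e1 e2 => (neval st e1 <= neval st e2)%N
  | BLeR e1 e2 => reval st e1 <= reval st e2
  | BNot e1 => ~~ beval st e1
  | BAnd e1 e2 => beval st e1 && beval st e2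
  end.

Fixpoint ncost (e : nexp) : nat :=
  match e with
  | NNum _ => 1
  | NGet _ i => (ncost i).+1
  | NAdd e1 e2 | NSub e1 e2 => (ncost e1 + ncost e2).+1
  end.

Fixpoint rcost (e : rexp) : nat :=
  match e with
  | RGet _ i => (ncost i).+1
  | RAdd e1 e2 | RSub e1 e2 => (rcost e1 + rcost e2).+1
  end.

Fixpoint bcost (e : bexp) : nat :=
  match e with
  | BLeN e1 e2 => (ncost e1 + ncost e2).+1
  | BLeR e1 e2 => (rcost e1 + rcost e2).+1
  | BNot e1 => (bcost e1).+1
  | BAnd e1 e2 => (bcost e1 + bcost e2).+1
  end.

(* [exec c st st' T]: started in st, c halts in st' after T steps. *)
Inductive exec (R : realType) : cmd -> state R -> state R -> nat -> Prop :=
| exec_skip st : exec Skip st st 1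
| exec_nset a i e st :
    exec (NSet a i e) st
      (State (upd (nmem st) a (neval st i) (neval st e)) (rmem st))
      (ncost i + ncost e).+1
| exec_rset a i e st :
    exec (RSet a i e) st
      (State (nmem st) (upd (rmem st) a (neval st i) (reval st e)))
      (ncost i + rcost e).+1
| exec_seq c1 c2 st1 st2 st3 T1 T2 :
    exec c1 st1 st2 T1 -> exec c2 st2 st3 T2 ->
    exec (Seq c1 c2) st1 st3 (T1 + T2)
| exec_if b c1 c2 st st' T :
    exec (if beval st b then c1 else c2) st st' T ->
    exec (If b c1 c2) st st' (bcost b + T)
| exec_while_stop b c st :
    ~~ beval st b -> exec (While b c) st st (bcost b)
| exec_while_loop b c st1 st2 st3 T1 T2 :
    beval st1 b -> exec c st1 st2 T1 -> exec (While b c) st2 st3 T2 ->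
    exec (While b c) st1 st3 (bcost b + T1 + T2).

Lemma exec_det (R : realType) c (st st1 st2 : state R) T1 T2 :
  exec c st st1 T1 -> exec c st st2 T2 -> st1 = st2 /\ T1 = T2.
Proof.
move=> H; elim: H st2 T2 => {c st st1 T1};
  intros; match goal with H : exec _ _ ?s ?t |- _ = ?s /\ _ = ?t =>
    inversion H; subst end;
  repeat match goal with
  | IH : forall _ _, exec ?c ?s _ _ -> _, H : exec ?c ?s _ _ |- _ =>
      have [? ?] := IH _ _ H; clear IH; subst
  | H : is_true (~~ ?b), H' : is_true ?b |- _ => by rewrite H' in H
  end; by [].
Qed.

(* Input: array 0 of naturals holds n, m, k, s, t; arrays 1 and 2 the end
   vertices of the edges and array 3 the positions of the agents; arrays 0 and
   1 of reals hold the edge weights and the budgets.  Other cells are 0. *)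
Definition load (R : realType) (I : instance R) : state R :=
  State
    (fun a => nth 0%N (nth [::]
       [:: [:: nv I; size (edges I); nag I; val (src I); val (dst I)];
           [seq val e.1.1 | e <- edges I];
           [seq val e.1.2 | e <- edges I];
           [seq val (pos i) | i <- enum 'I_(nag I)]] a))
    (fun a => nth 0 (nth [::]
       [:: [seq e.2 | e <- edges I];
           [seq budget i | i <- enum 'I_(nag I)]] a)).

Definition answers_yes (R : realType) (st : state R) : Prop :=
  nmem st 0 0 = 1%N.

(* Main.v *)
(* Root the tree at src.  The path to dst is then a segment [0, L], and the
   agent at p, at distance h from the path and with its projection at x, can
   carry the message from c to c' > c exactly when [c, c'] together with x
   spans a length of at most b = budget / 2 - h.  (Program and proofs double
   these coordinates, so that no division occurs.)  Delivery thus amounts to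
   covering [0, L] by such steps; zero-weight paths are treated apart.

   Greedily, among the agents with x - b <= c one always takes the one with
   the least deadline x + b.  This is optimal: if j is that agent and i is
   also available, then x_i + b_i <= c + 2 b_i and x_j + b_j <= c + 2 b_j, so
   that using j and then i already reaches the deadline of j.

   Distances and projections are computed in O(n) by repeatedly stripping
   leaves; for this, each vertex stores its degree, the sum of its
   neighbours and the sum of its incident weights, which for a leaf are the
   neighbour and the weight.  The agents wait in two tournament trees, keyed
   by x - b until they become available and by x + b afterwards, each update
   of which costs O(log k). *)
Require Import Defs.
From HB Require Import structures.
From mathcomp Require Import all_boot all_order all_algebra.
From mathcomp Require Import reals zify ring lra.

Set Implicit Arguments.
Unset Strict Implicit.
Unset Printing Implicit Defensive.

Import Order.TTheory GRing.Theory Num.Theory.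
Local Open Scope ring_scope.

(** * Greedy covering *)

(** Tours may turn at any point inside an edge, so no normal form for them is sought. The projection
    to the path and the distance from it are extended linearly to barycentric coordinates. One step
    of a walk changes only one of the two, and the projection only at distance 0, so lower bounds
    follow by induction on walks. Backward moves are absorbed by monotonicity of a covering step in
    its starting coordinate.

    Zero-weight paths are special because the empty sequence of agents then covers [0, L], whereas
    the message, with [src] and [dst] distinct, still needs an agent that can reach the path and
    return.

    The machine cannot divide, so the parent of a tournament node is looked up in a precomputed
    table of halves. Time is amortised by potentials read off the memory: the number of vertices not
    yet stripped, and the occupied leaves of the two trees, where each agent is moved over at most
    once and removed at most once. *)

Section Sweep.
Context (R : realType) (T : finType) (x b : T -> R).

(** The outer maximum lets an agent idle when its deadline has passed or its range is negative; the
    latter happens when the detour to the path exceeds the budget. *)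
Definition advance (i : T) (c : R) : R :=
  if x i - b i <= c then Num.max c (Num.min (c + b i) (x i + b i)) else c.

Definition sweep (o : seq T) (c : R) : R := foldl (fun c i => advance i c) c o.

Definition coverable (l c : R) (A : {set T}) : Prop :=
  exists o, [/\ uniq o, {subset o <= A} & l <= sweep o c].

Lemma advance_unavailable i c : c < x i - b i -> advance i c = c.
Proof. by rewrite /advance leNgt => ->. Qed.

Lemma advance_ge i c : c <= advance i c.
Proof. by rewrite /advance; case: ifP => // _; rewrite le_max lexx. Qed.

Lemma advance_mono i : {homo advance i : c c' / c <= c'}.
Proof.
move=> c c' le_cc'; rewrite /advance; case: ifP => h.
  rewrite (le_trans h le_cc') ge_max le_max le_cc' /= le_max; apply/orP; right.
  by rewrite le_min !ge_min lerD2r le_cc' lexx orbT.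
apply: le_trans (advance_ge i c'); exact: le_cc'.
Qed.

Lemma sweep_mono o : {homo sweep o : c c' / c <= c'}.
Proof. by elim: o => //= i o IH c c' le_cc'; apply/IH/advance_mono. Qed.

Lemma sweep_cat o1 o2 c : sweep (o1 ++ o2) c = sweep o2 (sweep o1 c).
Proof. exact: foldl_cat. Qed.

(** Adding [x j - b j <= c] to [x j + b j <= x i + b i <= c + 2 * b i] gives [x j <= c + b i]. Hence
    the ranges of j and i, spent in succession from c, suffice for [x j + b j]. *)
Lemma advance_advance i j c :
  x i - b i <= c -> x j - b j <= c -> x j + b j <= x i + b i ->
  x j + b j <= advance i (advance j c).
Proof.
move=> ri rj dij; have le1 := advance_ge j c.
set y := advance j c in le1 *.
have hy : Num.min (c + b j) (x j + b j) <= y.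
  by rewrite /y /advance rj le_max lexx orbT.
rewrite /advance (le_trans ri le1) le_max.
case: (leP (x j + b j) y) => //= ltyd.
rewrite le_min dij andbT.
move: hy; rewrite ge_min => /orP[hy|]; last by lra.
lra.
Qed.

Lemma coverable_unavailable (l c : R) (A : {set T}) :
  (forall i, i \in A -> c < x i - b i) -> coverable l c A <-> l <= c.
Proof.
move=> hA; split=> [[o [_ oA]]|lc]; last by exists [::].
suff -> : sweep o c = c by [].
elim: o oA => //= i o IH oA.
rewrite advance_unavailable ?hA ?oA ?mem_head //.
by apply: IH => j jo; apply: oA; rewrite inE jo orbT.
Qed.

(* Exchange argument: both j and i are available at c, so that serving first j
   and then i reaches the deadline of j, which the solution serving i first
   cannot pass by means of j. *)
Lemma coverable_earliest_deadline (l c : R) (A : {set T}) (j : T) :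
  j \in A -> x j - b j <= c ->
  (forall i, i \in A -> x i - b i <= c -> x j + b j <= x i + b i) ->
  coverable l c A <-> coverable l (advance j c) (A :\ j).
Proof.
move=> jA rj dj; split=> [[o [uo oA lo]]|[o [uo oA lo]]]; last first.
  exists (j :: o); split=> //=.
    by rewrite uo andbT; apply/negP => /oA; rewrite !inE eqxx.
  by move=> i; rewrite inE => /predU1P[->//|/oA]; rewrite !inE => /andP[].
elim: o uo oA lo => [|i o IH] /=.
  by move=> _ _ lc; exists [::]; split=> //; exact: le_trans lc (advance_ge _ _).
move=> /andP[io uo] oA lo.
have oA' k : k \in o -> k \in A by move=> ko; apply: oA; rewrite inE ko orbT.
have iA : i \in A by apply: oA; rewrite mem_head.
have [ri|ri] := leP (x i - b i) c; last first.
  by apply: IH => //; move: lo; rewrite advance_unavailable.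
have [eij|nij] := eqVneq i j.
  subst i; exists o; split=> // k ko; rewrite !inE oA' // andbT.
  by apply: contraNneq io => <-.
have [jo|jo] := boolP (j \in o); last first.
  exists (i :: o); split=> /=; first by rewrite io.
    move=> k ko; rewrite !inE oA // andbT; apply: contraTneq ko => ->.
    by rewrite inE negb_or eq_sym nij.
  apply: le_trans lo _; apply/sweep_mono/advance_mono; exact: advance_ge.
have := dj _ iA ri => dij.
case/splitPr: jo uo io oA' lo {IH oA} => X Y.
rewrite cat_uniq /= mem_cat inE !negb_or.
move=> /and4P[uX /andP[jX XY] jY uY] /and3P[iX _ iY] oA'.
rewrite sweep_cat /= => lo.
set z := sweep X (advance i c) in lo.
have hmem s : uniq (i :: s) -> {subset s <= X ++ Y} -> 
    [/\ uniq (i :: s) & {subset (i :: s) <= A :\ j}].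
  move=> us sXY; split=> // k; rewrite !inE => /predU1P[->|/sXY].
    by rewrite nij iA.
  rewrite mem_cat => /orP[h|h].
    by rewrite oA' ?mem_cat ?h // andbT; apply: contraNneq jX => <-.
  by rewrite oA' ?mem_cat ?inE ?h ?orbT // andbT; apply: contraNneq jY => <-.
(* If X stops before the deadline of j, then j followed by i gets at least as far as i, X and j
   together, so X is dropped. Otherwise j idles at z, and X is kept. *)
have [zd|dz] := leP z (x j + b j).
  have [||u s] := hmem Y; first by rewrite /= iY.
    by move=> k kY; rewrite mem_cat kY orbT.
  exists (i :: Y); split=> //=; apply: le_trans lo _; apply: sweep_mono.
  apply: le_trans (advance_advance ri rj dij).
  by rewrite /advance; case: ifP => // _; rewrite ge_max zd ge_min lexx orbT.
have [||u s] := hmem (X ++ Y); rewrite //=.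
  by rewrite mem_cat negb_or iX iY cat_uniq uX XY.
exists (i :: X ++ Y); split=> //=; rewrite sweep_cat.
apply: le_trans lo _; apply: sweep_mono.
have -> : advance j z = z.
  rewrite /advance; case: ifP => // _; apply/max_idPl.
  by rewrite ge_min (ltW dz) orbT.
apply/sweep_mono/advance_mono; exact: advance_ge.
Qed.

End Sweep.

(** * Cost-aware reasoning about programs *)

Section ProgramLogic.
Context (R : realType).
Implicit Types (st : state R) (c : cmd) (Q : state R -> Prop).

Definition runs c st (n : nat) Q : Prop :=
  exists st' T, [/\ exec c st st' T, (T <= n)%N & Q st'].

Fixpoint straight c : bool :=
  match c with
  | Seq c1 c2 | If _ c1 c2 => straight c1 && straight c2
  | While _ _ => false
  | _ => true
  end.

(** Charging both branches of a conditional makes the bound independent of the state. *)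
Fixpoint straight_cost c : nat :=
  match c with
  | Skip | While _ _ => 1
  | NSet _ i e => (ncost i + ncost e).+1
  | RSet _ i e => (ncost i + rcost e).+1
  | Seq c1 c2 => straight_cost c1 + straight_cost c2
  | If b c1 c2 => bcost b + (straight_cost c1 + straight_cost c2)
  end.

Fixpoint sem c st : state R :=
  match c with
  | Skip | While _ _ => st
  | NSet a i e =>
      State (upd (nmem st) a (neval st i) (neval st e)) (rmem st)
  | RSet a i e =>
      State (nmem st) (upd (rmem st) a (neval st i) (reval st e))
  | Seq c1 c2 => sem c2 (sem c1 st)
  | If b c1 c2 => if beval st b then sem c1 st else sem c2 st
  end.

Lemma sem_seq c1 c2 st : sem (Seq c1 c2) st = sem c2 (sem c1 st).
Proof. by []. Qed.

Lemma straight_exec c st : straight c ->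
  exists2 T, exec c st (sem c st) T & (T <= straight_cost c)%N.
Proof.
elim: c st => [|a i e|a i e|c1 IH1 c2 IH2|b c1 IH1 c2 IH2|//] st /=.
- by move=> _; exists 1%N => //; constructor.
- by move=> _; exists (ncost i + ncost e).+1 => //; constructor.
- by move=> _; exists (ncost i + rcost e).+1 => //; constructor.
- move=> /andP[s1 s2]; have [T1 e1 l1] := IH1 st s1.
  have [T2 e2 l2] := IH2 (sem c1 st) s2.
  by exists (T1 + T2)%N; [exact: exec_seq e1 e2 | exact: leq_add].
- move=> /andP[s1 s2]; have [T1 e1 l1] := IH1 st s1.
  have [T2 e2 l2] := IH2 st s2.
  exists (bcost b + (if beval st b then T1 else T2))%N.
    by constructor; case: (beval st b).
  by rewrite leq_add2l; case: (beval st b); lia.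
Qed.

Lemma runs_straight c st n Q :
  straight c -> (straight_cost c <= n)%N -> Q (sem c st) -> runs c st n Q.
Proof.
move=> sc le_n q; have [T ex le_T] := straight_exec st sc.
by exists (sem c st), T; split=> //; exact: leq_trans le_T le_n.
Qed.

Lemma runs_weaken c st n n' Q Q' :
  runs c st n Q -> (n <= n')%N -> (forall st', Q st' -> Q' st') ->
  runs c st n' Q'.
Proof.
move=> [st' [T [ex le_T q]]] le_n QQ'.
by exists st', T; split; [|exact: leq_trans le_T le_n|exact: QQ'].
Qed.

Lemma runs_seq c1 c2 st n1 n2 Q1 Q :
  runs c1 st n1 Q1 -> (forall st', Q1 st' -> runs c2 st' n2 Q) ->
  runs (Seq c1 c2) st (n1 + n2) Q.
Proof.
move=> [st1 [T1 [e1 l1 q1]]] h; have [st2 [T2 [e2 l2 q2]]] := h _ q1.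
by exists st2, (T1 + T2)%N; split=> //; [exact: exec_seq e1 e2|exact: leq_add].
Qed.

Lemma runs_if b c1 c2 st n Q :
  runs (if beval st b then c1 else c2) st n Q ->
  runs (If b c1 c2) st (bcost b + n) Q.
Proof.
move=> [st' [T [ex le_T q]]]; exists st', (bcost b + T)%N.
by split=> //; [exact: exec_if|rewrite leq_add2l].
Qed.

Lemma bcost_gt0 b : (0 < bcost b)%N.
Proof. by case: b. Qed.

(* The potential phi pays for the remaining iterations; what is left of it at
   the end can still be spent after the loop. *)
Lemma runs_while b c st (Inv : state R -> Prop) (phi : state R -> nat) Q :
  Inv st ->
  (forall st, Inv st -> beval st b -> exists m, runs c st m
     (fun st' => Inv st' /\ (bcost b + m + phi st' <= phi st)%N)) ->
  (forall st, Inv st -> ~~ beval st b -> Q st) ->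
  exists m, runs (While b c) st m
    (fun st' => Q st' /\ (m + phi st' <= phi st + bcost b)%N).
Proof.
move=> inv step fin.
suff [st' [T [ex le_T q]]] : exists st' T,
    [/\ exec (While b c) st st' T, (T + phi st' <= phi st + bcost b)%N & Q st'].
  by exists T, st', T; split.
have [p] := ubnP (phi st); elim: p => // p IH in st inv *.
rewrite ltnS => le_p; have [hb|hb] := boolP (beval st b); last first.
  exists st, (bcost b); split; [exact: exec_while_stop|lia|exact: fin].
have [m [st1 [T1 [e1 l1 [inv1 lphi]]]]] := step _ inv hb.
have b0 := bcost_gt0 b.
have [|st2 [T2 [e2 l2 q2]]] := IH st1 inv1; first lia.
exists st2, (bcost b + T1 + T2)%N; split=> //; last lia.
exact: exec_while_loop e1 e2.
Qed.

(** Frames are syntactic: an array that is never the target of an assignment keeps its contents,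
    which carries facts from one phase of the program to the next. *)
Fixpoint nwrites c : seq nat :=
  match c with
  | NSet a _ _ => [:: a]
  | Seq c1 c2 | If _ c1 c2 => nwrites c1 ++ nwrites c2
  | While _ c1 => nwrites c1
  | _ => [::]
  end.

Fixpoint rwrites c : seq nat :=
  match c with
  | RSet a _ _ => [:: a]
  | Seq c1 c2 | If _ c1 c2 => rwrites c1 ++ rwrites c2
  | While _ c1 => rwrites c1
  | _ => [::]
  end.

Definition agree_outside (ns rs : seq nat) st st' : Prop :=
  (forall a j, a \notin ns -> nmem st' a j = nmem st a j) /\
  (forall a j, a \notin rs -> rmem st' a j = rmem st a j).

Lemma agree_outside_trans ns rs ns' rs' st st' st'' :
  agree_outside ns rs st st' -> agree_outside ns' rs' st' st'' ->
  agree_outside (ns ++ ns') (rs ++ rs') st st''.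
Proof.
move=> [n1 r1] [n2 r2].
by split=> a j; rewrite mem_cat negb_or => /andP[h1 h2];
  [rewrite n2 ?n1|rewrite r2 ?r1].
Qed.

Lemma exec_frame c st st' T :
  exec c st st' T -> agree_outside (nwrites c) (rwrites c) st st'.
Proof.
elim=> {c st st' T} //=.
- move=> a i e st; split=> // b j; rewrite inE => /negPf h.
  by rewrite /= /upd h.
- move=> a i e st; split=> // b j; rewrite inE => /negPf h.
  by rewrite /= /upd h.
- move=> c1 c2 st1 st2 st3 T1 T2 _ [n1 r1] _ [n2 r2].
  by split=> a j; rewrite mem_cat negb_or => /andP[h1 h2];
    [rewrite n2 ?n1|rewrite r2 ?r1].
- move=> b c1 c2 st st' T _ [n1 r1].
  by split=> a j; rewrite mem_cat negb_or => /andP[h1 h2];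
    [apply: n1|apply: r1]; case: ifP.
- move=> b c st1 st2 st3 T1 T2 _ _ [n1 r1] _ [n2 r2].
  by split=> a j h; [rewrite n2 ?n1|rewrite r2 ?r1].
Qed.

Lemma sem_frame c st : straight c ->
  agree_outside (nwrites c) (rwrites c) st (sem c st).
Proof. by move=> /(straight_exec st)[T /exec_frame]. Qed.

Lemma runs_frame c st n Q : runs c st n Q ->
  runs c st n
    (fun st' => Q st' /\ agree_outside (nwrites c) (rwrites c) st st').
Proof.
move=> [st' [T [ex le_T q]]]; exists st', T; split=> //; split=> //.
exact: exec_frame ex.
Qed.

End ProgramLogic.

(* A scalar is cell 0 of an array of its own.  Arrays of naturals: 4 degree,
   5 sum of the neighbours and later the parent, 6 stripping order, 7 marks of
   the path, 8 halves, 9 and 10 the tournament trees; scalars: 11 loop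
   counter, 12 current vertex, 13 number of stripped vertices, 14 loop flag
   and answer, 15 auxiliary vertex or tree node, 16 agent + 1.  Arrays of
   reals: 2 sum of the incident weights and later the weight of the edge to
   the parent, 3 distance from src, 4 distance of the projection, 5 release
   coordinate, 6 deadline, 7 range; scalars: 8 covered length, 9 its
   candidate, 10 zero (never written). *)
Definition NVar (a : nat) : nexp := NGet a (NNum 0).
Definition NAssign (a : nat) (e : nexp) : cmd := NSet a (NNum 0) e.
Definition RVar (a : nat) : rexp := RGet a (NNum 0).
Definition RAssign (a : nat) (e : rexp) : cmd := RSet a (NNum 0) e.
Definition Incr (a : nat) : cmd := NAssign a (NAdd (NVar a) (NNum 1)).

Definition For (a : nat) (e : nexp) (c : cmd) : cmd :=
  Seq (NAssign a (NNum 0))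
      (While (BLeN (NAdd (NVar a) (NNum 1)) e) (Seq c (Incr a))).

(** Each round costs [5 + ncost e] for the test and 6 for the increment; the first assignment takes
    3 and the failing test again [5 + ncost e]. The potential [phi] allows a round to exceed K when
    earlier savings pay for it. *)
Lemma runs_for (R : realType) a e c (st : state R) n N K
    (Inv : nat -> state R -> Prop) (phi : state R -> nat) Q :
  Inv 0 (sem (NAssign a (NNum 0)) st) ->
  (forall i st, (i <= N)%N -> Inv i st -> nmem st a 0 = i -> neval st e = N) ->
  (forall i st, (i < N)%N -> Inv i st -> nmem st a 0 = i ->
     exists m, runs c st m
       (fun st' => [/\ nmem st' a 0 = i, Inv i.+1 (sem (Incr a) st') &
          m + phi (sem (Incr a) st') <= K + phi st]%N)) ->
  (forall st, Inv N st -> Q st) ->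
  (phi (sem (NAssign a (NNum 0)) st) + N * (K + 11 + ncost e) + 8 + ncost e
     <= n)%N ->
  runs (For a e c) st n Q.
Proof.
move=> inv0 hN step fin le_n.
set st0 := sem _ st in inv0 le_n.
rewrite (_ : n = 3 + (n - 3))%N; last by lia.
apply: (@runs_seq _ _ _ _ _ _ (fun st' => st' = st0)).
  by apply: runs_straight.
move=> _ ->.
have := @runs_while _ (BLeN (NAdd (NVar a) (NNum 1)) e) (Seq c (Incr a)) st0
  (fun st => exists2 i, (i <= N)%N & Inv i st /\ nmem st a 0 = i)
  (fun st => (phi st + (N - nmem st a 0) * (K + 11 + ncost e))%N) Q.
case.
- by exists 0%N => //; split=> //; rewrite /st0 /= /upd !eqxx.
- move=> st1 [i le_i [inv ia]] /=; rewrite (hN _ _ le_i inv ia) ia addn1.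
  move=> lt_i; have [m hm] := step _ _ lt_i inv ia.
  exists (m + 6)%N; apply: (runs_seq hm) => st2 [i2 inv2 lphi].
  apply: runs_straight => //; split.
    by exists i.+1 => //; split=> //; rewrite /= /upd !eqxx i2 /= addn1.
  rewrite [X in (N - X)%N]/= /upd !eqxx i2 /= addn1.
  have -> : (N - i = (N - i.+1).+1)%N by lia.
  move: lphi; rewrite mulSn /Incr /= i2; lia.
- move=> st1 [i le_i [inv ia]] /=; rewrite (hN _ _ le_i inv ia) ia addn1.
  rewrite -ltnNge ltnS => ge_i; apply: fin.
  by have <- : i = N by lia.
move=> m [st' [T [ex le_T [q le_m]]]]; exists st', T; split=> //.
have e0 : nmem st0 a 0 = 0%N by rewrite /st0 /= /upd !eqxx.
move: le_m le_n; rewrite e0 subn0 [bcost _]/=.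
move: ((N - nmem st' a 0) * _)%N (N * _)%N => X Y; lia.
Qed.

(** * Rooting the tree *)

(** The interface between the graph and the later arguments. [child] sends an edge to its end away
    from the root; being a bijection onto the other vertices, it turns sums over the edge list into
    sums over vertices. *)
Record rooted (R : realType) (I : instance R) (root : 'I_(nv I))
    (par : 'I_(nv I) -> 'I_(nv I)) (dep : 'I_(nv I) -> nat)
    (wt : 'I_(nv I) -> R) (child : 'I_(nv I) * 'I_(nv I) * R -> 'I_(nv I)) :
    Prop := Rooted {
  par_root : par root = root;
  dep_root : dep root = 0%N;
  dep_par : forall v, v != root -> dep v = (dep (par v)).+1;
  wt_ge0 : forall v, v != root -> 0 <= wt v;
  child_perm : perm_eq [seq child e | e <- edges I]
                       [seq v <- enum 'I_(nv I) | v != root];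
  childP : forall e, e \in edges I ->
    e = (child e, par (child e), wt (child e)) \/
    e = (par (child e), child e, wt (child e)) }.

Lemma has_rcons_cat (T : Type) (p : pred T) s : has p s ->
  exists s1 a s2, [/\ s = rcons s1 a ++ s2, p a & ~~ has p s1].
Proof. by case/split_find => a s1 s2 pa ns1; exists s1, a, s2. Qed.

Section RootedTree.
Context (R : realType) (I : instance R) (root : 'I_(nv I)).
Hypotheses (validI : valid I) (treeI : is_tree I).
Notation V := 'I_(nv I).
Notation e := (@adj R I).

Lemma adj_sym (u v : V) : e u v = e v u.
Proof. by apply: eq_has => x; rewrite orbC. Qed.

Lemma adj_neq (u v : V) : e u v -> u != v.
Proof.
case: validI => h _ _ _ /hasP[[[u' v'] c] /h[uv _]] /=.
by case/orP=> /eqP[<- <-] //; rewrite eq_sym.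
Qed.

(** Tuples of fixed length make this decidable, so that [ex_minn] can define the depth as a
    breadth-first distance. *)
Definition reaches (v : V) (n : nat) : bool :=
  [exists p : n.-tuple V, path e root p && (last root p == v)].

Lemma reachesP v n :
  reflect (exists p, [/\ path e root p, last root p = v & size p = n])
          (reaches v n).
Proof.
apply: (iffP existsP) => [[p /andP[hp /eqP hl]]|[p [hp hl hs]]].
  by exists p; split=> //; rewrite size_tuple.
by exists (tcast hs (in_tuple p)); rewrite val_tcast hp hl eqxx.
Qed.

Lemma reachable v : exists n, reaches v n.
Proof.
case: treeI => conn _; have /connectP[p hp hl] := conn root v.
by exists (size p); apply/reachesP; exists p.
Qed.

Definition depth v := ex_minn (reachable v).

Definition parent v : V :=
  odflt v [pick u | e u v && (depth v == (depth u).+1)].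

Lemma depth_min v n : reaches v n -> (depth v <= n)%N.
Proof. by rewrite /depth; case: ex_minnP => m _ h /h. Qed.

Lemma depth_root : depth root = 0%N.
Proof.
by apply/eqP; rewrite -leqn0; apply/depth_min/reachesP; exists [::].
Qed.

Lemma parentP v : v != root -> e (parent v) v /\ depth v = (depth (parent v)).+1.
Proof.
move=> v_root; rewrite /parent; case: pickP => [u /andP[? /eqP]//|].
have [p [hp hl hs]] : exists p,
    [/\ path e root p, last root p = v & size p = depth v].
  by apply/reachesP; rewrite /depth; case: ex_minnP.
case: (lastP p) => [|q x] in hp hl hs *.
  by move: v_root; rewrite -hl eqxx.
move: hp hl; rewrite rcons_path last_rcons => /andP[hq eqx] xv; subst x.
move=> /(_ (last root q)); rewrite eqx -hs size_rcons eqSS.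
move/negbT/negP=> []; rewrite eqn_leq.
have -> : (depth (last root q) <= size q)%N.
  by apply/depth_min/reachesP; exists q.
rewrite andbT -ltnS -[X in (X <= _)%N](size_rcons q v) hs.
have [r [hr hrl hrs]] : exists r,
    [/\ path e root r, last root r = last root q
      & size r = depth (last root q)].
  by apply/reachesP; rewrite /depth; case: ex_minnP.
apply/depth_min/reachesP; exists (rcons r v).
by rewrite rcons_path last_rcons size_rcons hrl hrs hr eqx.
Qed.

Lemma parent_root : parent root = root.
Proof.
by rewrite /parent; case: pickP => // u; rewrite depth_root andbF.
Qed.

Definition chain v := traject parent v (depth v).+1.

Lemma chain_cons v : v != root -> chain v = v :: chain (parent v).
Proof. by move=> /parentP[_ d]; rewrite /chain d. Qed.

Lemma chain_root : chain root = [:: root].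
Proof. by rewrite /chain depth_root. Qed.

Lemma parent_ind (P : V -> Prop) :
  P root -> (forall v, v != root -> P (parent v) -> P v) -> forall v, P v.
Proof.
move=> Proot Pstep v; move: {2}(depth v) (erefl (depth v)) => n.
elim: n v => [|n IH] v; have [->//|/[dup] v_root /parentP[_ d]] := eqVneq v root.
  by rewrite d.
by rewrite d => -[] /IH; apply: Pstep.
Qed.

Lemma chain_facts v :
  [/\ root \in chain v, path e v (behead (chain v)), head root (chain v) = v,
      uniq (chain v) & forall u, u \in chain v -> (depth u <= depth v)%N].
Proof.
elim/parent_ind: v => [|v v_root [h1 h2 h3 h4 h5]].
  by rewrite chain_root mem_head; split=> // u; rewrite inE => /eqP->.
have [ev d] := parentP v_root.
rewrite (chain_cons v_root); split=> //; first by rewrite in_cons h1 orbT.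
- by rewrite /= adj_sym ev.
- by rewrite cons_uniq h4 andbT; apply/negP => /h5; rewrite d ltnn.
- by move=> u; rewrite in_cons => /predU1P[->//|/h5]; rewrite d => /leqW.
Qed.

(** The chains of u and v, cut at their first common vertex and closed by the edge, form a simple
    cycle. Acyclicity leaves at most two vertices on it, so one end is the parent of the other. *)
Lemma adj_parent (u v : V) : e u v -> parent u = v \/ parent v = u.
Proof.
move=> euv; have [ru pu hu uu _] := chain_facts u.
have [rv pv hv uv _] := chain_facts v.
have hh : has (mem (chain v)) (chain u) by apply/hasP; exists root.
case: treeI => _ acyc.
have nxt z a s z' : chain z' = z :: a :: s -> parent z' = a.
  have [->|?] := eqVneq z' root; rewrite ?chain_root // chain_cons // => -[_].
  by have [_ _ <- _ _] := chain_facts (parent z') => ->.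
have [s1 [a [s1' [cu av ns1]]]] := has_rcons_cat hh.
have /has_rcons_cat[s2 [a' [s2' [cv /eqP aa _]]]] : has (pred1 a) (chain v).
  by rewrite has_pred1.
subst a'.
have path1 : path e u (behead (rcons s1 a)).
  move: pu; rewrite cu; case: (s1) => [|x t] //=.
  by rewrite cat_path => /andP[].
have path2 : path e v (behead (rcons s2 a)).
  move: pv; rewrite cv; case: (s2) => [|x t] //=.
  by rewrite cat_path => /andP[].
have head1 : head root (rcons s1 a) = u by rewrite -hu cu; case: (s1).
have head2 : head root (rcons s2 a) = v by rewrite -hv cv; case: (s2).
have last1 : last u (behead (rcons s1 a)) = a.
  by move: head1; case: (s1) => [|x t] //= _; rewrite last_rcons.
have unq : uniq (rcons s1 a ++ rev s2).
  rewrite cat_uniq rev_uniq; move: uu uv; rewrite cu cv !cat_uniq.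
  move=> /andP[-> _] /andP[]; rewrite rcons_uniq => /andP[as2 ->] _.
  rewrite /= andbT; apply/hasPn => x; rewrite mem_rev => xs2.
  rewrite mem_rcons inE negb_or; apply/andP; split.
    by apply: contraNneq as2 => <-.
  have xv : x \in chain v by rewrite cv mem_cat mem_rcons inE xs2 orbT.
  by apply: contra ns1 => xs1; apply/hasP; exists x.
have cyc : cycle e (rcons s1 a ++ rev s2).
  have -> : rcons s1 a ++ rev s2 = u :: (behead (rcons s1 a) ++ rev s2).
    by move: head1; case: (s1) => [|x t] /= ->.
  rewrite /= rcons_cat cat_path path1 last1 /=.
  move: path2 head2; case: (s2) => [|y t] /= path2 head2.
    by rewrite head2 adj_sym euv.
  rewrite head2 in path2 *; rewrite rcons_path.
  rewrite rev_cons last_rcons adj_sym euv andbT -rev_cons.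
  rewrite -(belast_rcons v t a) -{1}(last_rcons v t a) rev_path.
  by rewrite (eq_path (e' := e)) // => x y'; rewrite adj_sym.
have [big|] := ltnP 2 (size (rcons s1 a ++ rev s2)).
  by have := acyc _ big; rewrite /ucycleb cyc unq.
rewrite size_cat size_rcons size_rev.
move=> small; case: s1 s2 small head1 head2 cu cv {path1 path2 last1 unq cyc ns1}
  => [|x [|? ?]] [|y [|? ?]] //= _ h1 h2 cu cv; last by left; rewrite -h2; apply: nxt cu.
- by have := adj_neq euv; rewrite -h1 -h2 eqxx.
- by right; rewrite -h1; apply: nxt cv.
Qed.

Definition child (x : V * V * R) : V :=
  if parent x.1.1 == x.1.2 then x.1.1 else x.1.2.

Definition weight (v : V) : R :=
  head 0 [seq x.2 | x <- edges I & child x == v].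

Lemma child_edge x : x \in edges I ->
  child x != root /\
  (x.1 = (child x, parent (child x)) \/ x.1 = (parent (child x), child x)).
Proof.
case: x => [[u v] c] xI; have euv : e u v.
  by apply/hasP; exists (u, v, c) => //=; rewrite eqxx.
have uv := adj_neq euv; rewrite /child /=; case: (parent u =P v) => [puv|npuv].
  split; last by (left; rewrite puv).
  by apply: contraNneq uv => ur; rewrite -puv ur parent_root.
have [//|pvu] := adj_parent euv; split; last by (right; rewrite pvu).
by apply: contraNneq uv => vr; rewrite -pvu vr parent_root.
Qed.

(** The child determines both ends of its edge, and [valid] excludes parallel edges. *)
Lemma child_inj : {in edges I &, injective child}.
Proof.
move=> x y xI yI exy; case: validI => _ unq _ _.
have ends z : z \in edges I ->
    [set z.1.1; z.1.2] = [set child z; parent (child z)].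
  by move=> /child_edge[_ [->|->]] //=; rewrite setUC.
have := ends _ xI; rewrite exy -ends // => exy'.
have sz z : z \in edges I -> (index z (edges I) < size (edges I))%N.
  by rewrite index_mem.
rewrite -(nth_index x xI) -(nth_index x yI); congr nth; apply/eqP.
rewrite -(nth_uniq set0 _ _ unq) ?size_map ?sz //.
by rewrite !(nth_map x) ?sz // !nth_index // exy'.
Qed.

Lemma weight_child x : x \in edges I -> weight (child x) = x.2.
Proof.
move=> xI; rewrite /weight.
have : x \in [seq y <- edges I | child y == child x].
  by rewrite mem_filter eqxx.
case E : [seq y <- _ | _] => [//|y s] _ /=.
have : y \in [seq y <- edges I | child y == child x] by rewrite E mem_head.
rewrite mem_filter => /andP[/eqP c yI]. by rewrite (child_inj yI xI c).
Qed.

Lemma rooted_tree : @rooted R I root parent depth weight child.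
Proof.
have chP x : x \in edges I ->
    x = (child x, parent (child x), weight (child x)) \/
    x = (parent (child x), child x, weight (child x)).
  move=> xI; rewrite (weight_child xI); case: (child_edge xI) => _.
  by case: x xI => [p c] _ /= [<-|<-]; [left|right].
have ex v : v != root -> exists2 x, x \in edges I & child x = v.
  move=> vr; have [/[dup] ev /hasP[x xI hx] d] := parentP vr.
  exists x => //; case: (child_edge xI) => cr hc.
  have [_ dc] := parentP cr.
  (* Otherwise v and its parent would each be deeper than the other. *)
  have bad : child x = parent v -> parent (child x) = v -> child x = v.
    by move=> e1 e2; move: d dc; rewrite e2 e1; lia.
  by case: hc => ec; move: hx; rewrite ec => /orP[] /eqP[e1 e2] //; exact: bad.
split=> //.
- exact: parent_root.
- exact: depth_root.
- by move=> v /parentP[].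
- move=> v /ex[[[u u'] c] xI <-]; rewrite (weight_child xI).
  by case: validI => h _ _ _; case: (h _ _ _ xI).
- apply: uniq_perm; last 1 first.
  + move=> v; rewrite mem_filter mem_enum andbT; apply/mapP/idP => [[x xI ->]|].
      by case: (child_edge xI).
    by move=> /ex[x xI <-]; exists x.
  + rewrite map_inj_in_uniq; last exact: child_inj.
    by case: validI => _ /map_uniq.
  + by rewrite filter_uniq // enum_uniq.
Qed.

End RootedTree.

(** * Lower bounds on tours *)

Section Geometry.
Context (R : realType) (I : instance R).
Notation V := 'I_(nv I).
Context (par : V -> V) (dep : V -> nat) (wt : V -> R) (child : V * V * R -> V).
Notation root := (src I).
Notation goal := (dst I).
Hypothesis rootedI : rooted root par dep wt child.

Lemma par_ind (P : V -> Prop) :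
  P root -> (forall v, v != root -> P (par v) -> P v) -> forall v, P v.
Proof.
move=> Proot Pstep v; move: {2}(dep v) (erefl (dep v)) => n.
elim: n v => [|n IH] v; have [->//|v_root] := eqVneq v root;
  rewrite (dep_par rootedI v_root) => //.
by case=> /IH; apply: Pstep.
Qed.

Definition dist (v : V) : R := \sum_(j < dep v) wt (iter j par v).

Lemma dist_root : dist root = 0.
Proof. by rewrite /dist (dep_root rootedI) big_ord0. Qed.

Lemma dist_par v : v != root -> dist v = dist (par v) + wt v.
Proof.
move=> v_root; rewrite /dist (dep_par rootedI v_root) big_ord_recl addrC.
by congr (_ + _); apply: eq_bigr => j _; rewrite -iterSr.
Qed.

Lemma dist_ge0 v : 0 <= dist v.
Proof.
elim/par_ind: v => [|v vr h]; first by rewrite dist_root.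
by rewrite dist_par // addr_ge0 // (wt_ge0 rootedI).
Qed.

(** The trajectory stops just short of the root, so that v also stands for the path edge between v
    and [par v]. *)
Definition onpath (v : V) : bool := v \in traject par goal (dep goal).

Lemma onpathP v : reflect (exists2 m, (m < dep goal)%N & v = iter m par goal)
  (onpath v).
Proof. exact: trajectP. Qed.

Lemma dep_iter m : (m <= dep goal)%N -> dep (iter m par goal) = (dep goal - m)%N.
Proof.
elim: m => [|m IH] le_m; first by rewrite subn0.
have dm := IH (ltnW le_m); rewrite iterS.
have nr : iter m par goal != root.
  by apply/eqP => e; move: dm; rewrite e (dep_root rootedI); lia.
by move: (dep_par rootedI nr); lia.
Qed.

Lemma onpath_root v : onpath v -> v != root.
Proof.
move=> /onpathP[m lt_m ->]; apply/eqP => e.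
by have := dep_iter (ltnW lt_m); rewrite e (dep_root rootedI); lia.
Qed.

Lemma onpath_goal : root != goal -> onpath goal.
Proof.
move=> src_dst; apply/onpathP; exists 0%N => //.
by rewrite (dep_par rootedI) // eq_sym.
Qed.

Lemma onpath_par v : onpath v -> par v != root -> onpath (par v).
Proof.
move=> /onpathP[m lt_m ->] nr; apply/onpathP; exists m.+1 => //.
have := dep_iter lt_m; rewrite iterS (dep_par rootedI nr); lia.
Qed.

Lemma path_ind (P : V -> Prop) :
  (forall v, onpath v -> par v = root -> P v) ->
  (forall v, onpath v -> onpath (par v) -> P (par v) -> P v) ->
  forall v, onpath v -> P v.
Proof.
move=> h0 h1; elim/par_ind => [/onpath_root|v vr IH hv]; first by rewrite eqxx.
have [e|ne] := eqVneq (par v) root; first exact: h0.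
have hp := onpath_par hv ne; exact: h1 (IH hp).
Qed.

Fixpoint anchor_rec (n : nat) (v : V) : V :=
  if n is n'.+1 then if onpath v then v else anchor_rec n' (par v) else v.

(* The vertex of the path between src and dst that is closest to v *)
Definition anchor (v : V) : V := anchor_rec (dep v) v.

Lemma anchor_onpath v : onpath v -> anchor v = v.
Proof. by rewrite /anchor; case: (dep v) => //= n ->. Qed.

Lemma anchor_root : anchor root = root.
Proof. by rewrite /anchor (dep_root rootedI). Qed.

Lemma anchor_par v : v != root -> ~~ onpath v -> anchor v = anchor (par v).
Proof. by move=> vr /negPf h; rewrite /anchor (dep_par rootedI vr) /= h. Qed.

Definition along (v : V) : R := dist (anchor v).
Definition away (v : V) : R := dist v - along v.

Lemma along_onpath v : onpath v -> along v = dist v.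
Proof. by move=> h; rewrite /along anchor_onpath. Qed.

Lemma along_root : along root = 0.
Proof. by rewrite /along anchor_root dist_root. Qed.

Lemma away_root : away root = 0.
Proof. by rewrite /away along_root dist_root subr0. Qed.

Lemma away_onpath v : onpath v -> away v = 0.
Proof. by move=> h; rewrite /away along_onpath ?subrr. Qed.

Lemma away_onpath_par v : onpath v -> away (par v) = 0.
Proof.
move=> h; have [->|nr] := eqVneq (par v) root; first exact: away_root.
by rewrite away_onpath ?onpath_par.
Qed.

(** Off the path the anchor is inherited from the parent; on the path both ends of the edge are
    their own anchors. With [away_par], every edge thus changes at most one of the two
    coordinates. *)
Lemma along_par v : v != root ->
  along v = along (par v) + (if onpath v then wt v else 0).
Proof.
move=> vr; case: ifP => h; last by rewrite addr0 /along anchor_par ?h.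
rewrite along_onpath // dist_par //; congr (_ + _).
by have := away_onpath_par h; rewrite /away; lra.
Qed.

Lemma away_par v : v != root ->
  away v = away (par v) + (if onpath v then 0 else wt v).
Proof.
by move=> vr; rewrite /away dist_par // along_par //; case: ifP => _; lra.
Qed.

Lemma away_ge0 v : 0 <= away v.
Proof.
elim/par_ind: v => [|v vr h]; first by rewrite away_root.
rewrite away_par // addr_ge0 //; case: ifP => // _; exact: wt_ge0 rootedI _ vr.
Qed.

Lemma dist_path v : onpath v -> dist v <= dist goal.
Proof.
move=> /onpathP[m lt_m ->]; elim: m lt_m => // m IH lt_m.
apply: le_trans (IH (ltnW lt_m)).
have nr : iter m par goal != root.
  by apply: onpath_root; apply/onpathP; exists m => //; exact: ltnW.
by rewrite (dist_par nr) lerDl (wt_ge0 rootedI).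
Qed.

Lemma anchorP v : anchor v = root \/ onpath (anchor v).
Proof.
elim/par_ind: v => [|v vr h]; first by left; rewrite anchor_root.
have [hv|hv] := boolP (onpath v); last by rewrite anchor_par.
by right; rewrite anchor_onpath.
Qed.

Lemma along_ge0 v : 0 <= along v. Proof. exact: dist_ge0. Qed.

Lemma along_le v : along v <= dist goal.
Proof.
rewrite /along; case: (anchorP v) => [->|]; last exact: dist_path.
by rewrite dist_root dist_ge0.
Qed.

(** Depending only on the barycentric coordinates, the extension is the same for all descriptions of
    a location as a point of an edge. *)
Definition linear_ext (f : V -> R) (y : location I) : R := \sum_v y v * f v.

Lemma linear_ext_edge f u v a :
  linear_ext f (on_edge u v a) = (1 - a) * f u + a * f v.
Proof.
have sum1 x : \sum_v (v == x)%:R * f v = f x.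
  rewrite (bigD1 x) //= eqxx mul1r big1 ?addr0 // => j /negPf ->.
  by rewrite mul0r.
rewrite /linear_ext; under eq_bigr => x _ do rewrite ffunE mulrDl -!mulrA.
by rewrite big_split /= -!mulr_sumr !sum1.
Qed.

Lemma on_edge0 (u v : V) : on_edge u v 0 = at_vertex u.
Proof. by apply/ffunP => x; rewrite !ffunE subr0 mul1r mul0r addr0. Qed.

Lemma on_edge1 (u v : V) : on_edge u v 1 = at_vertex v.
Proof. by apply/ffunP => x; rewrite !ffunE subrr mul1r mul0r add0r. Qed.

Lemma on_edgeC (u v : V) (a : R) : on_edge u v a = on_edge v u (1 - a).
Proof. by apply/ffunP => x; rewrite !ffunE; ring. Qed.

Lemma linear_ext_vertex f u : linear_ext f (at_vertex u) = f u.
Proof. by rewrite -(on_edge0 u u) linear_ext_edge; ring. Qed.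

Notation al := (linear_ext along).
Notation aw := (linear_ext away).

Lemma child_root x : x \in edges I -> child x != root.
Proof.
move=> xI; have := perm_mem (child_perm rootedI) (child x).
by rewrite map_f // mem_filter => /esym/andP[].
Qed.

Lemma edge_step u v c a b : (u, v, c) \in edges I -> 0 <= a <= 1 -> 0 <= b <= 1 ->
  let y := on_edge u v a in let y' := on_edge u v b in
  0 <= aw y /\
  ([/\ aw y = 0, aw y' = 0, al y - al y' <= `|a - b| * c
     & al y' - al y <= `|a - b| * c] \/
   [/\ al y = al y', aw y - aw y' <= `|a - b| * c
     & aw y' - aw y <= `|a - b| * c]).
Proof.
move=> eI /andP[a0 a1] /andP[b0 b1] /=; split.
  by rewrite linear_ext_edge; have := away_ge0 u; have := away_ge0 v; nra.
move: (child_root eI) (childP rootedI eI); move: (child _) => x xr hx.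
have w0 := wt_ge0 rootedI xr.
have n1 : (a - b) * wt x <= `|a - b| * wt x by rewrite ler_wpM2r // ler_norm.
have n2 : (b - a) * wt x <= `|a - b| * wt x.
  by rewrite ler_wpM2r // distrC ler_norm.
have hal := along_par xr; have haw := away_par xr.
have px := @away_onpath_par x; have rx := @away_onpath x.
rewrite !linear_ext_edge.
case: hx => -[-> -> ->]; case: (boolP (onpath x)) hal haw px rx => hp hal haw;
  [move=> /(_ isT) px /(_ isT) rx; left|move=> _ _; right
  |move=> /(_ isT) px /(_ isT) rx; left|move=> _ _; right].
- by rewrite px rx hal; split; lra.
- by rewrite haw hal; split; lra.
- by rewrite px rx hal; split; lra.
- by rewrite haw hal; split; lra.
Qed.

(** A walk between different projections must descend to the path and climb again, so both distances
    add to its length. The assumption on y is there because [walk_stay] admits arbitrary functions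
    as locations. *)
Lemma walk_bounds y z l : walk y z l -> 0 <= aw y ->
  [/\ 0 <= aw z, aw y - aw z <= l, aw z - aw y <= l &
      [/\ al y - al z <= l, al z - al y <= l &
          al y != al z -> aw y + aw z + (al y - al z) <= l /\
                          aw y + aw z + (al z - al y) <= l]].
Proof.
elim=> {y z l} [y|u v c a b z l eI ha hb _ IH] y0.
  by split; rewrite ?subrr //; split; rewrite ?subrr ?eqxx.
have [_ step] := edge_step eI ha hb; have [b0 _] := edge_step eI hb hb.
have [z0 w1 w2 [a1 a2 ne]] := IH b0; move: step => /=.
set d := `|a - b| * c => step.
have d0 : 0 <= d by case: step => -[]; lra.
case: step => [[e1 e2 s1 s2]|[e1 s1 s2]]; (split; [lra|lra|lra|]);
  (split; [lra|lra|]).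
- have [eb _|h _] := eqVneq (al (on_edge u v b)) (al z); first by split; lra.
  by case: (ne h) => ? ?; split; lra.
- by rewrite e1 => h; case: (ne h) => ? ?; split; lra.
Qed.

Definition carrier_pos (i : 'I_(nag I)) : R := along (pos i) + along (pos i).
Definition carrier_range (i : 'I_(nag I)) : R :=
  budget i - away (pos i) - away (pos i).

Lemma tour_advance i q r l1 l2 l3 :
  walk (at_vertex (pos i)) q l1 -> walk q r l2 ->
  walk r (at_vertex (pos i)) l3 -> l1 + l2 + l3 <= budget i -> al q < al r ->
  al r + al r <= advance carrier_pos carrier_range i (al q + al q).
Proof.
move=> w1 w2 w3 hb lt_qr.
have p0 : 0 <= aw (at_vertex (pos i)) by rewrite linear_ext_vertex away_ge0.
have [q0 b1 b2 [a1 a2 n1]] := walk_bounds w1 p0.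
have [r0 c1 c2 [d1 d2 n2]] := walk_bounds w2 q0.
have [_ f1 f2 [g1 g2 n3]] := walk_bounds w3 r0.
have [m1 m2] := n2 (negbT (lt_eqF lt_qr)).
rewrite !linear_ext_vertex in n1 n3 b1 b2 a1 a2 f1 f2 g1 g2.
rewrite /advance /carrier_pos /carrier_range.
set p := along _ in n1 n3 a1 a2 g1 g2 *; set h := away _ in n1 n3 b1 b2 f1 f2 *.
(* The closed tour descends to the path, returns, and covers twice the span of the three
   projections. Where p coincides with the projection of q or r, the walk between them contributes
   only the difference of distances, which suffices. *)
have hq : [/\ 2 * h + 2 * (al r - al q) <= budget i,
   2 * h + 2 * (p - al q) <= budget i & 2 * h + 2 * (al r - p) <= budget i].
  have [e1|/n1[? ?]] := eqVneq p (al q); have [e3|/n3[? ?]] := eqVneq (al r) p;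
    split; lra.
case: hq => h1 h2 h3.
have -> : p + p - (budget i - h - h) <= al q + al q by lra.
by rewrite le_max le_min; apply/orP; right; apply/andP; split; lra.
Qed.

(** A backward move cannot outrun [advance], which never decreases; a forward move is bounded by
    [tour_advance], and a larger start only helps. *)
Lemma relay_sweep (S : schedule I) o y z c :
  returning_within_budget S -> relay S o y z -> al y + al y <= c ->
  al z + al z <= sweep carrier_pos carrier_range o c.
Proof.
move=> hS; elim: o y c => [|i o IH] y c /=; first by move=> ->.
case=> y' Si rel le_c; apply: (IH _ _ rel).
have [lt_yy'|le_y'y] := ltP (al y) (al y'); last first.
  by apply: le_trans (advance_ge _ _ _ _); lra.
have [l1 [l2 [l3 [w1 w2 w3 hb]]]] := hS _ _ _ Si.
exact: le_trans (tour_advance w1 w2 w3 hb lt_yy') (advance_mono _ _ _ le_c).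
Qed.

Lemma delivery_coverable : root != goal -> returning_delivery I ->
  coverable carrier_pos carrier_range (dist goal + dist goal) 0 [set: 'I_(nag I)].
Proof.
move=> src_dst [S [[o [uo _ rel]] hS]]; exists o; split=> //.
  by move=> i _; rewrite inE.
have := relay_sweep hS rel; rewrite !linear_ext_vertex along_root addr0.
by rewrite along_onpath ?onpath_goal //; apply.
Qed.

(** The relay has a first agent because [src] and [dst] are different locations. It picks the
    message up at distance 0 from the path and therefore pays its detour twice. *)
Lemma delivery_range :
  root != goal -> returning_delivery I -> exists i, 0 <= carrier_range i.
Proof.
move=> src_dst [S [[[|i o] [_ _ /= rel]] hS]].
  have := congr1 (fun f : location I => f goal) rel.
  rewrite !ffunE eqxx eq_sym (negPf src_dst) => /eqP.
  by rewrite eq_sym oner_eq0.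
case: rel => r Si _; have [l1 [l2 [l3 [w1 w2 w3 hb]]]] := hS _ _ _ Si.
have p0 : 0 <= aw (at_vertex (pos i)) by rewrite linear_ext_vertex away_ge0.
have [q0 b1 b2 _] := walk_bounds w1 p0.
have [r0 c1 c2 _] := walk_bounds w2 q0.
have [_ f1 f2 _] := walk_bounds w3 r0.
rewrite !linear_ext_vertex away_root in b1 b2 c1 c2 f1 f2.
by exists i; rewrite /carrier_range; lra.
Qed.

End Geometry.

(** * Schedules from coverings *)

Section Schedules.
Context (R : realType) (I : instance R).
Notation V := 'I_(nv I).
Context (par : V -> V) (dep : V -> nat) (wt : V -> R) (child : V * V * R -> V).
Notation root := (src I).
Notation goal := (dst I).
Hypotheses (rootedI : rooted root par dep wt child) (src_dst : root != goal).
Notation dist := (dist par dep wt).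
Notation onpath := (onpath par dep).
Notation along := (along par dep wt).
Notation away := (away par dep wt).
Notation anchor := (anchor par dep).
Notation carrier_pos := (carrier_pos par dep wt).
Notation carrier_range := (carrier_range par dep wt).

Lemma walk_length (x y : location I) l l' : walk x y l -> l = l' -> walk x y l'.
Proof. by move=> w <-. Qed.

Lemma walk_trans (x y z : location I) l l' :
  walk x y l -> walk y z l' -> walk x z (l + l').
Proof.
elim=> {x y l} [x|u v c a b y l eI ha hb _ IH] w; first by rewrite add0r.
by rewrite -addrA; apply: (walk_along eI ha hb); apply: IH.
Qed.

Lemma walk_sym (x y : location I) l : walk x y l -> walk y x l.
Proof.
elim=> {x y l} [x|u v c a b y l eI ha hb _ w]; first exact: walk_stay.
apply: walk_length (walk_trans w (walk_along eI hb ha (walk_stay _))) _.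
by rewrite distrC; ring.
Qed.

Lemma walk_par_edge v a b : v != root -> 0 <= a <= 1 -> 0 <= b <= 1 ->
  walk (on_edge v (par v) a) (on_edge v (par v) b) (`|a - b| * wt v).
Proof.
move=> vr ha hb.
have : v \in [seq v <- enum 'I_(nv I) | v != root] by rewrite mem_filter vr mem_enum.
rewrite -(perm_mem (child_perm rootedI)) => /mapP[x xI ->].
have := xI; move: (childP rootedI xI); move: (child x) => y [->|->] eI.
  by apply: walk_length (walk_along eI ha hb (walk_stay _)) _; rewrite addr0.
rewrite 2!(on_edgeC y).
apply: walk_length (walk_along eI _ _ (walk_stay _)) _; [lra|lra|].
rewrite addr0; congr (_ * _); rewrite distrC; congr (`|_|); ring.
Qed.

Lemma walk_to_par v : v != root -> walk (at_vertex v) (at_vertex (par v)) (wt v).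
Proof.
move=> vr; rewrite -(on_edge0 v (par v)) -(on_edge1 v (par v)).
apply: walk_length (walk_par_edge vr _ _) _; rewrite ?lexx ?ler01 //.
by rewrite sub0r normrN normr1 mul1r.
Qed.

Lemma walk_to_anchor v : walk (at_vertex v) (at_vertex (anchor v)) (away v).
Proof.
elim/(par_ind rootedI): v => [|v vr h].
  rewrite (anchor_root rootedI) (away_root rootedI); exact: walk_stay.
have [hv|hv] := boolP (onpath v).
  rewrite (anchor_onpath hv) (away_onpath _ hv); exact: walk_stay.
rewrite (anchor_par rootedI vr hv) (away_par rootedI vr) (negPf hv) addrC.
exact: walk_trans (walk_to_par vr) h.
Qed.

(* y lies on the path from src to dst, at distance c from src.  Several
   locations can share a coordinate because edges may have weight 0. *)
Definition path_point (y : location I) (c : R) : Prop :=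
  exists v a, [/\ onpath v, 0 <= a <= 1, y = on_edge v (par v) a
    & c = dist v - a * wt v].

Lemma path_point_vertex v : onpath v -> path_point (at_vertex v) (dist v).
Proof.
move=> hv; exists v, 0; split=> //; first by rewrite lexx ler01.
  by rewrite on_edge0.
by rewrite mul0r subr0.
Qed.

Lemma path_point_goal : path_point (at_vertex goal) (dist goal).
Proof. exact: path_point_vertex (onpath_goal rootedI src_dst). Qed.

Lemma path_point_root : path_point (at_vertex root) 0.
Proof.
move: goal (onpath_goal rootedI src_dst); apply: (path_ind rootedI) => // v hv e.
exists v, 1; split=> //; first by rewrite lexx ler01.
  by rewrite on_edge1 e.
by rewrite (dist_par rootedI (onpath_root rootedI hv)) e (dist_root rootedI); ring.
Qed.

Lemma path_point_anchor v : path_point (at_vertex (anchor v)) (along v).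
Proof.
rewrite /along; case: (anchorP rootedI v) => [->|/path_point_vertex//].
rewrite (dist_root rootedI); exact: path_point_root.
Qed.

Lemma path_point_exists c : 0 <= c <= dist goal -> exists y, path_point y c.
Proof.
move=> /andP[c0]; move: goal (onpath_goal rootedI src_dst).
apply: (path_ind rootedI) => [v hv e|v hv hp IH] le_c.
all: have vr := onpath_root rootedI hv; have dv := dist_par rootedI vr.
all: have w0 := wt_ge0 rootedI vr.
all: have [le_pc|lt_cp] := leP (dist (par v)) c; last first.
all: try by [apply: IH; exact: ltW | move: lt_cp; rewrite e (dist_root rootedI); lra].
(* On a zero-weight edge the fraction would divide by 0, but there c is the coordinate of the vertex
   v. *)
all: have [wv|wv] := eqVneq (wt v) 0;
  first by (exists (at_vertex v); rewrite (_ : c = dist v); [exact: path_point_vertex|lra]).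
all: have wp : 0 < wt v by lra.
all: exists (on_edge v (par v) ((dist v - c) / wt v)); exists v, ((dist v - c) / wt v).
all: split; [by []| |by []|by rewrite divfK //; ring].
all: by rewrite divr_ge0 ?ler_pdivrMr ?mul1r //=; lra.
Qed.

Lemma dist_iter n v : dist (iter n par v) <= dist v.
Proof.
elim: n => // n IH; rewrite iterS; apply: le_trans IH.
have [->|vr] := eqVneq (iter n par v) root; first by rewrite (par_root rootedI).
by rewrite (dist_par rootedI vr) lerDl (wt_ge0 rootedI).
Qed.

Lemma walk_up m n : (m + n <= dep goal)%N ->
  walk (at_vertex (iter m par goal)) (at_vertex (iter (m + n) par goal))
       (dist (iter m par goal) - dist (iter (m + n) par goal)).
Proof.
elim: n => [|n IH] le_n; first by rewrite addn0 subrr; exact: walk_stay.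
have lt_n : (m + n < dep goal)%N by lia.
have hp : onpath (iter (m + n) par goal) by apply/onpathP; exists (m + n)%N.
have vr := onpath_root rootedI hp.
rewrite addnS iterS; apply: walk_length (walk_trans (IH (ltnW lt_n)) (walk_to_par vr)) _.
by rewrite (dist_par rootedI vr); ring.
Qed.

Lemma walk_path_points y y' c c' :
  path_point y c -> path_point y' c' -> walk y y' `|c - c'|.
Proof.
move=> [v [a [hv ha -> ->]]] [v' [a' [hv' ha' -> ->]]].
have /onpathP[m lt_m ev] := hv; have /onpathP[m' lt_m' ev'] := hv'.
wlog le_m : v v' a a' m m' hv hv' ha ha' lt_m lt_m' ev ev' / (m <= m')%N.
  move=> h; have [le_m|/ltnW le_m] := leqP m m'.
    exact: (h v v' a a' m m').
  by apply: walk_sym; rewrite distrC; apply: (h v' v a' a m' m).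
have vr := onpath_root rootedI hv; have vr' := onpath_root rootedI hv'.
have w0 := wt_ge0 rootedI vr; have w0' := wt_ge0 rootedI vr'.
case: ltngtP le_m => // [lt_mm'|em] _; last first.
  have evv : v' = v by rewrite ev ev' em.
  rewrite evv; apply: walk_length (walk_par_edge vr ha ha') _.
  rewrite -{1}(ger0_norm w0) -normrM -normrN; congr (`|_|); ring.
have le_m' : (m.+1 + (m' - m.+1) <= dep goal)%N by lia.
have := walk_up le_m'; rewrite subnKC // iterS -ev -ev' => wu.
have i0 : (0 : R) <= (0 : R) <= (1 : R) by lra.
have i1 : (0 : R) <= (1 : R) <= (1 : R) by lra.
have w1 := walk_par_edge vr ha i1; have w2 := walk_par_edge vr' i0 ha'.
rewrite on_edge1 in w1; rewrite on_edge0 in w2.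
apply: walk_length (walk_trans w1 (walk_trans wu w2)) _.
have dv := dist_par rootedI vr.
have le_up : 0 <= dist (par v) - dist v'.
  rewrite subr_ge0 (_ : v' = iter (m' - m.+1) par (par v)); first exact: dist_iter.
  by rewrite ev' ev -iterS -iterD subnK.
move: ha ha' => /andP[a0 a1] /andP[a0' a1'].
rewrite ler0_norm ?subr_le0 // sub0r normrN (ger0_norm a0').
rewrite ger0_norm; first by rewrite dv; ring.
by rewrite dv; nra.
Qed.

(** Going to the anchor, then to y, y' and back costs twice the detour plus twice the span of the
    three coordinates. Each hypothesis bounds the span for one choice of its extreme points. *)
Lemma tour_exists i y y' c c' :
  path_point y c -> path_point y' c' -> c <= c' ->
  carrier_pos i - carrier_range i <= c + c ->
  c' + c' <= c + c + carrier_range i ->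
  c' + c' <= carrier_pos i + carrier_range i ->
  exists l1 l2 l3, [/\ walk (at_vertex (pos i)) y l1, walk y y' l2,
    walk y' (at_vertex (pos i)) l3 & l1 + l2 + l3 <= budget i].
Proof.
rewrite /carrier_pos /carrier_range => hy hy' le_c h1 h2 h3.
have wp := walk_to_anchor (pos i); have hp := path_point_anchor (pos i).
exists (away (pos i) + `|along (pos i) - c|), `|c - c'|,
  (`|c' - along (pos i)| + away (pos i)); split.
- exact: walk_trans wp (walk_path_points hp hy).
- exact: walk_path_points hy hy'.
- exact: walk_trans (walk_path_points hy' hp) (walk_sym wp).
rewrite (distrC c c') (ger0_norm (_ : 0 <= c' - c)) ?subr_ge0 //.
by case: (ger0P (along (pos i) - c)) => ?; case: (ger0P (c' - along (pos i))) => ?; lra.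
Qed.

Lemma relay_eq (S S' : schedule I) o y z :
  {in o, S =1 S'} -> relay S o y z -> relay S' o y z.
Proof.
elim: o y => //= i o IH y SS' [x Si rel].
exists x; first by rewrite -SS' ?mem_head.
by apply: IH rel => j jo; apply: SS'; rewrite inE jo orbT.
Qed.

(** Agents that gain nothing are dropped, hence the subsequence. The strict bound on c forces a
    final move onto the goal: at equality, y could be another location with the same coordinate. *)
Lemma sweep_relay o y c : uniq o -> path_point y c -> 0 <= c -> c < dist goal ->
  dist goal + dist goal <= sweep carrier_pos carrier_range o (c + c) ->
  exists S : schedule I, exists o', [/\ uniq o', {subset o' <= o},
    forall i, (i \in o') = isSome (S i), returning_within_budget S
    & relay S o' y (at_vertex goal)].
Proof.
elim: o y c => [|i o IH] y c /=; first by move=> _ _ c0 lt_c le_c; lra.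
move=> /andP[io uo] hy c0 lt_c.
have skip : advance carrier_pos carrier_range i (c + c) <= c + c ->
    dist goal + dist goal <=
      sweep carrier_pos carrier_range o (advance carrier_pos carrier_range i (c + c)) ->
    exists S : schedule I, exists o', [/\ uniq o', {subset o' <= i :: o},
      forall i, (i \in o') = isSome (S i), returning_within_budget S
      & relay S o' y (at_vertex goal)].
  move=> le_adv le_sw; have [|S [o' [uo' so' hS bS rS]]] := IH y c uo hy c0 lt_c.
    exact: le_trans le_sw (sweep_mono _ _ _ le_adv).
  by exists S, o'; split=> // j /so' jo; rewrite inE jo orbT.
have [le_adv|lt_adv] := leP (advance carrier_pos carrier_range i (c + c)) (c + c).
  exact: skip.
move=> le_sw {skip}.
have [ri hadv] : carrier_pos i - carrier_range i <= c + c /\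
    advance carrier_pos carrier_range i (c + c) <=
    Num.min (c + c + carrier_range i) (carrier_pos i + carrier_range i).
  move: lt_adv; rewrite /advance; case: ifP => [ri|_]; last by rewrite ltxx.
  by rewrite lt_max ltxx /= => lt_m; split=> //; rewrite ge_max (ltW lt_m) lexx.
move: hadv; rewrite le_min => /andP[h1 h2].
set c2 := advance _ _ _ _ in lt_adv le_sw h1 h2.
(* [c2] may overshoot the end of the path; this agent then drops the message at the goal, and the
   rest of the sequence stays at home. *)
have [ge_c2|lt_c2] := leP (dist goal + dist goal) c2.
  exists (fun j => if j == i then Some (y, at_vertex goal) else None), [:: i].
  split=> //=.
  - by move=> j; rewrite !inE => /eqP->; rewrite eqxx.
  - by move=> j; rewrite inE; case: eqP.
  - move=> j q r; case: eqP => // -> [<- <-].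
    by apply: (tour_exists hy path_point_goal); rewrite ?(ltW lt_c) //; lra.
  - by exists (at_vertex goal) => //; rewrite eqxx.
have [c' ec'] : exists c', c' + c' = c2 by exists (c2 / 2); field.
have [|y' hy'] := @path_point_exists c'; first by apply/andP; split; lra.
have [|||S [o' [uo' so' hS bS rS]]] := IH y' c' uo hy'; [lra|lra|by rewrite ec'|].
have io' : i \notin o' by apply: contra io => /so'.
exists (fun j => if j == i then Some (y, y') else S j), (i :: o'); split.
- by rewrite /= io'.
- by move=> j; rewrite !inE => /predU1P[->|/so'->]; rewrite ?eqxx ?orbT.
- by move=> j; rewrite inE; case: eqP => //= _; exact: hS.
- move=> j q r; case: eqP => [->|_]; last exact: bS.
  case=> <- <-; by apply: (tour_exists hy hy') => //; rewrite ?ec' //; lra.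
exists y'; first by rewrite eqxx.
apply: relay_eq rS => j jo' /=; case: eqP => // ji.
by rewrite ji (negPf io') in jo'.
Qed.

Lemma returning_deliveryP : returning_delivery I <->
  (if dist goal + dist goal <= 0 then exists i, 0 <= carrier_range i else
   coverable carrier_pos carrier_range (dist goal + dist goal) 0 [set: 'I_(nag I)]).
Proof.
have L0 := dist_ge0 rootedI goal.
case: ifP => [le0|/negbT]; last rewrite -ltNge => gt0.
  split; first exact: (delivery_range rootedI src_dst).
  have L : dist goal = 0 by lra.
  case=> i ri; exists (fun j => if j == i then
    Some (at_vertex root, at_vertex goal) else None); split.
    exists [:: i]; split=> //=; first by move=> j; rewrite inE; case: eqP.
    by exists (at_vertex goal) => //; rewrite eqxx.
  move=> j q r; case: eqP => // -> [<- <-].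
  have a0 : along (pos i) = 0.
    by apply/le_anti; rewrite (along_ge0 rootedI) andbT -L (along_le rootedI).
  apply: (tour_exists path_point_root path_point_goal);
    by rewrite ?L /carrier_pos ?a0; lra.
split; first exact: (delivery_coverable rootedI src_dst).
case=> o [uo _ le_sw].
have [||S [o' [uo' _ hS bS rS]]] := sweep_relay uo path_point_root (lexx 0).
- lra.
- by rewrite addr0.
by exists S; split=> //; exists o'.
Qed.

End Schedules.

(** * Tournament trees *)

Section Tournament.
Context (R : realType).

(* Node 0 is unused; node p has the children 2p and 2p+1; agent i sits at the
   leaf K + i.  A node holds 0 when no agent below it is present, and
   otherwise i + 1 for an agent i with the least key. *)
Definition winner (key : nat -> R) (a b : nat) : nat :=
  if (b <= 0)%N then a else if (0 < a)%N && (key (a - 1)%N <= key (b - 1)%N)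
  then a else b.

(** [q] is the one node whose entry may be out of date; [q = 0] exempts none. The last clause fixes
    node 1, which the program reads even when there are no agents. *)
Definition tournament (K : nat) (key : nat -> R) (T : nat -> nat)
    (S : pred nat) (q : nat) : Prop :=
  [/\ forall i, (i < K)%N -> T (K + i)%N = if S i then i.+1 else 0%N,
      forall p, (0 < p < K)%N -> p != q ->
        T p = winner key (T (p + p)%N) (T (p + p + 1)%N)
    & K = 0%N -> T 1%N = 0%N].

Lemma winnerP key a b :
  (winner key a b = a \/ winner key a b = b) /\
  forall x, x = a \/ x = b -> (0 < x)%N ->
    (0 < winner key a b)%N /\ key (winner key a b - 1)%N <= key (x - 1)%N.
Proof.
rewrite /winner; case: (leqP b 0) => [b0|b0]; last case: ifP => [/andP[a0 ab]|].
- split; first by left.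
  by move=> x [] -> // x0; lia.
- split; first by left.
  by move=> x [] ->.
move=> /negbT; rewrite negb_and -leqNgt -ltNge => h.
split; first by right.
by move=> x [] ->; case/orP: h => // h x0; [lia|rewrite (ltW h)].
Qed.

(** Positive entries stem from present leaves, and halving leads from each leaf to node 1 without
    increasing the winning key. So K may be any number, not only a power of two. *)
Lemma tournament_top K key T S : tournament K key T S 0 ->
  (T 1%N = 0%N -> forall i, (i < K)%N -> ~~ S i) /\
  (forall j, T 1%N = j.+1 ->
     [/\ (j < K)%N, S j & forall i, (i < K)%N -> S i -> key j <= key i]).
Proof.
move=> [leaves nodes none].
have up q x : (0 < q < K + K)%N -> (0 < x)%N ->
    (0 < T q)%N && (key (T q - 1)%N <= key (x - 1)%N) ->
    (0 < T 1%N)%N && (key (T 1%N - 1)%N <= key (x - 1)%N).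
  elim/ltn_ind: q => q IH q_lt x0 hq; have [q1|q2] := eqVneq q 1%N.
    by rewrite q1 in hq.
  have [hh hq2] : (0 < q./2 < K)%N /\ (q = q./2 + q./2 \/ q = q./2 + q./2 + 1)%N.
    by clear -q_lt q2; lia.
  apply: (IH q./2) => //; [lia|lia|].
  rewrite (nodes _ hh); last by lia.
  case/andP: hq => tq kq.
  have hx : T q = T (q./2 + q./2)%N \/ T q = T (q./2 + q./2 + 1)%N.
    by case: hq2 => e; [left|right]; rewrite {1}e.
  have [_ /(_ _ hx tq)[-> h]] := winnerP key (T (q./2 + q./2)%N) (T (q./2 + q./2 + 1)%N).
  exact: le_trans h kq.
have from p : (0 < p < K + K)%N -> T p = 0%N \/
    exists2 i, (i < K)%N & S i /\ T p = i.+1.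
  move: {2}(K + K - p)%N (leqnn (K + K - p)%N) => d.
  elim: d p => [|d IH] p le_d hp; first by lia.
  have [le_Kp|lt_pK] := leqP K p.
    rewrite -(subnKC le_Kp) leaves; last by lia.
    by case: ifP => h; [right; exists (p - K)%N => //; lia|left].
  have pK : (0 < p < K)%N by lia.
  rewrite (nodes _ pK); last by lia.
  have [[->|->] _] := winnerP key (T (p + p)%N) (T (p + p + 1)%N);
    apply: IH; lia.
have leaf i : (i < K)%N -> S i ->
    (0 < T 1%N)%N && (key (T 1%N - 1)%N <= key i).
  move=> lt_i Si; have hq : (0 < K + i < K + K)%N by lia.
  have := up _ i.+1 hq isT; rewrite leaves // Si subn1 /= lexx; exact.
split=> [t0 i lt_i|j t1].
  by apply/negP => /(leaf _ lt_i); rewrite t0.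
have [K0|K0] := posnP K; first by rewrite none in t1.
have h1 : (0 < 1 < K + K)%N by lia.
case: (from _ h1); rewrite t1 // => -[i lt_i [Si [e]]]; subst j; split=> // i' lt_i' Si'.
by have := leaf _ lt_i' Si'; rewrite t1 subn1 /=.
Qed.

Definition Replay (T key : nat) : cmd :=
  Seq (NAssign 15 (NGet 8 (NVar 15)))
    (let a := NGet T (NAdd (NVar 15) (NVar 15)) in
     let b := NGet T (NAdd (NAdd (NVar 15) (NVar 15)) (NNum 1)) in
     If (BLeN b (NNum 0)) (NSet T (NVar 15) a)
     (If (BAnd (BLeN (NNum 1) a)
               (BLeR (RGet key (NSub a (NNum 1))) (RGet key (NSub b (NNum 1)))))
       (NSet T (NVar 15) a) (NSet T (NVar 15) b))).

Definition Update (T key : nat) (pos val : nexp) : cmd :=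
  Seq (NAssign 15 pos) (Seq (NSet T (NVar 15) val)
    (While (BLeN (NNum 2) (NVar 15)) (Replay T key))).

Definition halves (K : nat) (H : nat -> nat) : Prop :=
  forall p, (p < K)%N -> H (p + p)%N = p /\ H (p + p + 1)%N = p.

(** [b] selects insertion or deletion. [val] is evaluated after scalar 15 has received the leaf
    index, hence the state in its hypothesis. *)
Lemma runs_update (T key : nat) pos val (st : state R) K S i v (b : bool) :
  T != 8%N -> T != 15%N ->
  halves K (nmem st 8) -> tournament K (rmem st key) (nmem st T) S 0 ->
  (i < K)%N -> neval st pos = (K + i)%N ->
  neval (sem (NAssign 15 pos) st) val = v ->
  v = (if b then i.+1 else 0)%N ->
  runs (Update T key pos val) st
    (100 * trunc_log 2 K + 200 + ncost pos + ncost val)%N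
    (fun st' => tournament K (rmem st' key) (nmem st' T)
       (fun j => if j == i then b else S j) 0).
Proof.
move=> /negPf T8 /negPf T15 hH [leaves nodes none] lt_i ep ev ev'.
have T8' : (8 == T)%N = false by rewrite eq_sym.
have T15' : (15 == T)%N = false by rewrite eq_sym.
set n := (X in runs _ _ X).
rewrite (_ : n = (2 + ncost pos) + ((4 + ncost val) + (100 * trunc_log 2 K + 194)))%N;
  last by rewrite /n; lia.
apply: (runs_seq (Q1 := fun st' => st' = sem (NAssign 15 pos) st)).
  by apply: runs_straight.
move=> _ ->.
apply: (runs_seq (Q1 := fun st' => st' =
    sem (NSet T (NVar 15) val) (sem (NAssign 15 pos) st))).
  by apply: runs_straight.
move=> _ ->.
pose S' j := if j == i then b else S j; set st1 := sem _ _.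
(* Changing an entry can invalidate only its parent; [Replay] repairs that node and passes the
   exemption upwards. At node 1 the exempt index is 0, so the tree is whole. *)
pose Inv (s : state R) := [/\ (0 < nmem s 15 0 < K + K)%N, halves K (nmem s 8), rmem s = rmem st
    & tournament K (rmem s key) (nmem s T) S' (nmem s 15 0)./2].
have := @runs_while R (BLeN (NNum 2) (NVar 15)) (Replay T key) st1 Inv
  (fun s => 100 * trunc_log 2 (nmem s 15 0))%N
  (fun s => tournament K (rmem s key) (nmem s T) S' 0).
case.
- have q_lt : (K + i < K + K)%N by lia.
  have e15 : nmem st1 15 0 = (K + i)%N.
    by rewrite /st1 /= /upd T15' /= ep.
  have tT j : nmem st1 T j = if j == (K + i)%N then v else nmem st T j.
    by rewrite -ev /st1 /= /upd /= eqxx T15 /= ep.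
  rewrite /Inv e15; split; [lia| |by []|].
    by move=> p; rewrite /st1 /= /upd T8' /=; exact: hH.
  split=> [j lt_j|p /andP[p0 pK] np|]; last by lia.
    by rewrite tT eqn_add2l leaves // /S' ev'; case: eqP => // ->.
  rewrite !tT !ifN_eq; [|lia|lia|lia].
  by rewrite nodes //; lia.
- move=> s [hq hHs er [lv nd nn]] /= lt_q.
  set q := nmem s 15 0 in hq lt_q nd *.
  have hh : (0 < q./2 < K)%N by lia.
  have [hq2 eq2] : (q = q./2 + q./2 \/ q = q./2 + q./2 + 1)%N /\ nmem s 8 q = q./2.
    have /hHs[h1 h2] : (q./2 < K)%N by lia.
    have : (q = q./2 + q./2 \/ q = q./2 + q./2 + 1)%N.
      by clear; lia.
    by move=> h; split=> //; case: h => {1}->.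
  pose body := Replay T key.
  exists (straight_cost body); apply: runs_straight => //.
  have eT j : nmem (sem body s) T j = if j == q./2 then
      winner (rmem s key) (nmem s T (q./2 + q./2)%N) (nmem s T (q./2 + q./2 + 1)%N)
    else nmem s T j.
    rewrite /body /Replay /= /upd /= T15 /= -?/q ?eq2 /winner.
    by case: ifP => _; last case: ifP => _; rewrite /= eqxx T15.
  have e15 : nmem (sem body s) 15 0 = q./2.
    rewrite /body /Replay /= /upd /= T15 /= -?/q ?eq2.
    by case: ifP => _; last case: ifP => _; rewrite /= T15'.
  have e8 j : nmem (sem body s) 8 j = nmem s 8 j.
    rewrite /body /Replay /= /upd /= T15 /=.
    by case: ifP => _; last case: ifP => _; rewrite /= T8'.
  have eR : rmem (sem body s) = rmem s.
    by rewrite /body /Replay /=; case: ifP => _; last case: ifP => _.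
  rewrite /Inv e15 eR; split.
    split=> //; first by lia.
      by move=> p /hHs; rewrite !e8.
    split=> [j lt_j|p hp np|K0]; last by lia.
      by rewrite eT lv //; case: eqP => //; lia.
    rewrite !eT; have [->|npq] := eqVneq p q./2.
      by rewrite !ifN_eq //; lia.
    by rewrite nd // !ifN_eq //; lia.
  rewrite (trunc_log2S lt_q) mulnS /body /=; lia.
- move=> s [hq hHs er h] /=; rewrite -ltnNge => lt_q.
  by have <- : (nmem s 15 0)./2 = 0%N by lia.
move=> m [st' [T' [ex le_T [top le_m]]]]; exists st', T'; split=> //.
have e15 : nmem st1 15 0 = (K + i)%N by rewrite /st1 /= /upd T15' /= ep.
(* The starting leaf lies below 2K, so the climb exceeds the logarithm of K by at most one level. *)
have log_le : (trunc_log 2 (K + i) <= trunc_log 2 K + 1)%N.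
  have K0 : (0 < K)%N by lia.
  apply: leq_trans (leq_trunc_log 2 (_ : K + i <= K.*2)%N) _; first by lia.
  by rewrite trunc_log2_double // addn1.
by move: le_m; rewrite e15 [bcost _]/=; lia.
Qed.

End Tournament.

(** * Stripping leaves *)

Section TreePhase.
Context (R : realType) (I : instance R).
Notation V := 'I_(nv I).

Record input (st : state R) : Prop := Input {
  input_n : nmem st 0 0 = nv I;
  input_m : nmem st 0 1 = size (edges I);
  input_k : nmem st 0 2 = nag I;
  input_s : nmem st 0 3 = val (src I);
  input_t : nmem st 0 4 = val (dst I);
  input_edge : forall x0 j, (j < size (edges I))%N ->
    let x := nth x0 (edges I) j in
    [/\ nmem st 1 j = val x.1.1, nmem st 2 j = val x.1.2 & rmem st 0 j = x.2];
  input_agent : forall i : 'I_(nag I),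
    nmem st 3 i = val (pos i) /\ rmem st 1 i = budget i }.

Lemma input_frame ns rs st st' : agree_outside ns rs st st' ->
  all (fun a => a \notin ns) [:: 0; 1; 2; 3]%N ->
  all (fun a => a \notin rs) [:: 0; 1]%N -> input st -> input st'.
Proof.
move=> [hn hr] /and5P[n0 n1 n2 n3 _] /and3P[r0 r1 _] [i0 i1 i2 i3 i4 i5 i6].
split; rewrite ?hn //; first by move=> x0 j /(i5 x0)/=; rewrite !hn // hr.
by move=> i; rewrite hn // hr.
Qed.

Context (par : V -> V) (dep : V -> nat) (wt : V -> R) (child : V * V * R -> V).
Notation root := (src I).
Hypothesis rootedI : rooted root par dep wt child.

Section Incidence.
Context (M : Type) (idx : M) (op : Monoid.com_law idx) (g : V -> R -> M).

(** The commutative monoid is kept abstract because degree, sum of neighbours and sum of weights are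
    three instances of one aggregate. *)
Definition incident (v : V) (e : V * V * R) : M :=
  op (if e.1.1 == v then g e.1.2 e.2 else idx)
     (if e.1.2 == v then g e.1.1 e.2 else idx).

(* The aggregate of g over the neighbours of v in the tree that remains when
   the vertices of o have been stripped, provided v is not in o. *)
Definition remaining (o : seq V) (v : V) : M :=
  op (\big[op/idx]_(c | [&& c != root, par c == v & c \notin o]) g c (wt c))
     (if v == root then idx else g (par v) (wt v)).

Lemma incident_remaining v :
  \big[op/idx]_(e <- edges I) incident v e = remaining [::] v.
Proof.
pose f c := op (if par c == v then g c (wt c) else idx)
               (if c == v then g (par c) (wt c) else idx).
transitivity (\big[op/idx]_(c <- [seq child e | e <- edges I]) f c).
  rewrite big_map; apply: eq_big_seq => e /(childP rootedI).
  move: (child e) => c [->|->]; rewrite /incident /f //=.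
  by rewrite Monoid.mulmC.
rewrite (perm_big _ (child_perm rootedI)) big_filter big_enum_cond /=.
rewrite big_split /=; congr (op _ _).
  rewrite -big_mkcondr; apply: eq_bigl => c.
  by rewrite in_nil andbT.
case: eqVneq => [->|vr].
  by rewrite big1 // => c /negPf ->.
rewrite (bigD1 v) //= eqxx big1 ?Monoid.mulm1 // => c /andP[_ /negPf ->].
by [].
Qed.

Lemma remaining_leaf o v : v != root ->
  (forall c, c != root -> par c = v -> c \in o) ->
  remaining o v = g (par v) (wt v).
Proof.
move=> vr h; rewrite /remaining (negPf vr) big_pred0 ?Monoid.mul1m // => c.
by apply/negP => /and3P[cr /eqP /(h _ cr) ->].
Qed.

Lemma remaining_rcons o u : u != root -> u \notin o ->
  remaining o (par u) = op (g u (wt u)) (remaining (rcons o u) (par u)).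
Proof.
move=> ur uo; rewrite /remaining Monoid.mulmA (bigD1 u) /=; last by rewrite ur eqxx.
congr (op (op _ _) _); apply: eq_bigl => c.
by rewrite mem_rcons inE negb_or -!andbA; do !bool_congr; rewrite andbC.
Qed.

Lemma remaining_rcons_neq o u v : v != par u ->
  remaining (rcons o u) v = remaining o v.
Proof.
move=> vu; rewrite /remaining; congr (op _ _); apply: eq_bigl => c.
rewrite mem_rcons inE negb_or; case: (eqVneq c u) => //= ->.
by rewrite (eq_sym (par u)) (negPf vu) !andbF.
Qed.

End Incidence.

Definition degree := @remaining nat 0%N addn (fun _ _ => 1%N).
Definition nbr_sum := @remaining nat 0%N addn (fun u _ => val u).
Definition wt_sum := @remaining R 0 +%R (fun _ c => c).

(** The edge to the parent already counts 1, so an unstripped child would raise the degree to 2. *)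
Lemma degree_le1 o v : v != root -> (degree o v <= 1)%N ->
  forall c, c != root -> par c = v -> c \in o.
Proof.
move=> vr dv c cr pc; apply: contraLR dv => co; rewrite -ltnNge.
rewrite /degree /remaining (negPf vr) (bigD1 c) /=; last by rewrite cr pc eqxx.
by rewrite /= addn1 ltnS leq_addr.
Qed.

Definition AddEdgeAt (a b : nexp) : cmd :=
  Seq (NSet 4 a (NAdd (NGet 4 a) (NNum 1)))
  (Seq (NSet 5 a (NAdd (NGet 5 a) b))
       (RSet 2 a (RAdd (RGet 2 a) (RGet 0 (NVar 11))))).

Definition Aggregate : cmd :=
  let u := NGet 1 (NVar 11) in let v := NGet 2 (NVar 11) in
  For 11 (NGet 0 (NNum 1)) (Seq (AddEdgeAt u v) (AddEdgeAt v u)).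

Lemma add_edge_at (s : state R) i x y : nmem s 11 0 = i ->
  (x, y) = (1, 2)%N \/ (x, y) = (2, 1)%N ->
  let a := nmem s x i in let b := nmem s y i in
  let s' := sem (AddEdgeAt (NGet x (NVar 11)) (NGet y (NVar 11))) s in
  [/\ forall j, nmem s' 4 j = (nmem s 4 j + (if j == a then 1 else 0))%N,
      forall j, nmem s' 5 j = (nmem s 5 j + (if j == a then b else 0))%N,
      forall j, rmem s' 2 j = rmem s 2 j + (if j == a then rmem s 0 i else 0)
    & forall z j, z \notin [:: 4; 5]%N -> nmem s' z j = nmem s z j].
Proof.
move=> e11 exy /=; split=> [j|j|j|z j].
4: by rewrite !inE negb_or /upd => /andP[/negPf -> /negPf ->].
all: by case: exy => -[-> ->]; rewrite /upd /= e11; case: eqP => [->|_];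
  rewrite ?addn0 ?addr0.
Qed.

Lemma add_edge_twice (s : state R) i : nmem s 11 0 = i ->
  let a := nmem s 1 i in let b := nmem s 2 i in
  let s' := sem (Seq (AddEdgeAt (NGet 1 (NVar 11)) (NGet 2 (NVar 11)))
    (AddEdgeAt (NGet 2 (NVar 11)) (NGet 1 (NVar 11)))) s in
  [/\ forall j, nmem s' 4 j =
        (nmem s 4 j + (if j == a then 1 else 0) + (if j == b then 1 else 0))%N,
      forall j, nmem s' 5 j =
        (nmem s 5 j + (if j == a then b else 0) + (if j == b then a else 0))%N,
      forall j, rmem s' 2 j = rmem s 2 j + (if j == a then rmem s 0 i else 0) +
        (if j == b then rmem s 0 i else 0)
    & nmem s' 11 0 = i].
Proof.
move=> e11; have [c4 c5 c2 cn] := add_edge_at e11 (or_introl erefl).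
move=> a b; rewrite sem_seq.
have r0 : rmem (sem (AddEdgeAt (NGet 1 (NVar 11)) (NGet 2 (NVar 11))) s) 0 i = rmem s 0 i.
  by [].
move: (sem (AddEdgeAt _ _) s) => s1 in c4 c5 c2 cn r0 *.
have e11' : nmem s1 11 0 = i by rewrite cn.
have [d4 d5 d2 dn] := add_edge_at e11' (or_intror erefl).
move: (sem _ s1) => s2 in d4 d5 d2 dn *.
have e1 : nmem s1 1 i = a by rewrite cn.
have e2 : nmem s1 2 i = b by rewrite cn.
cbv zeta; split=> [j|j|j|]; last by rewrite dn.
- by rewrite d4 c4 e2.
- by rewrite d5 c5 e1 e2.
- by rewrite d2 c2 e2 r0.
Qed.

Definition aggregates (o : seq V) (st : state R) : Prop :=
  forall v, v \notin o -> [/\ nmem st 4 v = degree o v,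
    nmem st 5 v = nbr_sum o v & rmem st 2 v = wt_sum o v].

Lemma runs_aggregate st : input st ->
  (forall j, nmem st 4 j = 0%N) -> (forall j, nmem st 5 j = 0%N) ->
  (forall j, rmem st 2 j = 0) ->
  runs Aggregate st (200 * (size (edges I)).+1) (aggregates [::]).
Proof.
move=> ist z4 z5 z2.
pose Inv i (s : state R) := input s /\ forall v : V,
  [/\ nmem s 4 v = \big[addn/0%N]_(e <- take i (edges I)) incident addn (fun _ _ => 1%N) v e,
      nmem s 5 v = \big[addn/0%N]_(e <- take i (edges I)) incident addn (fun u _ => val u) v e
    & rmem s 2 v = \big[+%R/0]_(e <- take i (edges I)) incident +%R (fun _ c => c) v e].
apply: (@runs_for R 11 _ _ st _ (size (edges I)) 100 Inv (fun=> 0%N)).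
- split; first by case: ist.
  by move=> v; rewrite take0 !big_nil /= /upd /= z4 z5 z2.
- by move=> i s _ [/input_m].
- move=> i s lt_i [si agg] e11; exists 80%N; apply: runs_straight => //.
  have [c4 c5 c2 c11] := add_edge_twice e11.
  have si1 := input_frame (sem_frame s (c := Seq (AddEdgeAt (NGet 1 (NVar 11))
    (NGet 2 (NVar 11))) (AddEdgeAt (NGet 2 (NVar 11)) (NGet 1 (NVar 11)))) isT)
    isT isT si.
  move: (sem _ s) => s1 in c4 c5 c2 c11 si1 *.
  split=> //.
    split; first by case: si1.
    have [eu ev ew] := input_edge si (root, root, 0) lt_i.
    move=> v; have [d1 d2 d3] := agg v.
    rewrite /= /upd /= c4 c5 c2 d1 d2 d3 eu ev ew {c4 c5 c2 d1 d2 d3}.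
    rewrite (take_nth (root, root, 0)) // -cats1 !big_cat !big_seq1 /=.
    rewrite /incident; move: (nth _ _ _) => [[a b] c] /=.
    rewrite !(eq_sym (nat_of_ord v)) !val_eqE.
    by split; rewrite -?addnA -?addrA.
- move=> s [_ agg] v _; have [-> -> ->] := agg v.
  by rewrite take_size !incident_remaining.
rewrite /=; lia.
Qed.

(** A stripped vertex retains its parent and the weight of the edge to it, and its degree 0 prevents
    a second stripping. Children precede parents, so the reversed order runs top-down. *)
Record stripping (o : seq V) (st : state R) : Prop := Stripping {
  strip_n : nmem st 13 0 = size o;
  strip_uniq : uniq o;
  strip_root : root \notin o;
  strip_order : forall j, (j < size o)%N -> nmem st 6 j = val (nth root o j);
  strip_children : forall j c, (j < size o)%N -> c != root ->
    par c = nth root o j -> c \in take j o;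
  strip_agg : aggregates o st;
  strip_done : forall v, v \in o ->
    [/\ nmem st 4 v = 0%N, nmem st 5 v = val (par v) & rmem st 2 v = wt v] }.

Lemma stripping_frame o ns rs st st' : agree_outside ns rs st st' ->
  all (fun a => a \notin ns) [:: 4; 5; 6; 13]%N -> 2%N \notin rs ->
  stripping o st -> stripping o st'.
Proof.
move=> [hn hr] /and5P[n4 n5 n6 n13 _] r2 [s1 s2 s3 s4 s5 s6 s7].
split; rewrite ?hn //.
- by move=> j; rewrite hn //; exact: s4.
- by move=> v; rewrite !hn // hr //; exact: s6.
- by move=> v; rewrite !hn // hr //; exact: s7.
Qed.

Definition EqN (a b : nexp) : bexp := BAnd (BLeN a b) (BLeN b a).

Definition StripVertex : cmd :=
  let u := NVar 12 in let p := NVar 15 in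
  Seq (NSet 6 (NVar 13) u)
  (Seq (Incr 13)
  (Seq (NSet 4 u (NNum 0))
  (Seq (NAssign 15 (NGet 5 u))
  (Seq (NSet 4 p (NSub (NGet 4 p) (NNum 1)))
  (Seq (NSet 5 p (NSub (NGet 5 p) u))
  (Seq (RSet 2 p (RSub (RGet 2 p) (RGet 2 u)))
       (NAssign 12 p))))))).

Definition Strippable : bexp :=
  BAnd (EqN (NGet 4 (NVar 12)) (NNum 1))
       (BNot (EqN (NVar 12) (NGet 0 (NNum 3)))).

Definition Strip : cmd :=
  For 11 (NGet 0 (NNum 0))
    (Seq (NAssign 12 (NVar 11)) (While Strippable StripVertex)).

Lemma beval_EqN (st : state R) a b :
  beval st (EqN a b) = (neval st a == neval st b).
Proof. by rewrite /= eqn_leq. Qed.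

Lemma beval_Strippable (st : state R) (u : V) : input st -> nmem st 12 0 = u ->
  beval st Strippable = (nmem st 4 u == 1%N) && (u != root).
Proof.
move=> ist e12; rewrite -[beval _ _]/(beval st (EqN _ _) && ~~ beval st (EqN _ _)).
by rewrite !beval_EqN /= e12 (input_s ist) val_eqE.
Qed.

Lemma par_neq v : v != root -> par v != v.
Proof.
by move=> vr; apply/eqP => e; have := dep_par rootedI vr; rewrite e; lia.
Qed.

Lemma strip_vertex o (u : V) st : stripping o st -> u != root ->
  nmem st 12 0 = u -> nmem st 4 u = 1%N ->
  [/\ u \notin o, stripping (rcons o u) (sem StripVertex st),
    nmem (sem StripVertex st) 12 0 = par u
    & forall v : V, v != par u -> nmem (sem StripVertex st) 4 v = 1%N ->
        nmem st 4 v = 1%N /\ v != u].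
Proof.
move=> [sn su sr so sc sa sd] ur e12 d1.
have uo : u \notin o by apply/negP => /sd[]; rewrite d1.
have [du nu wu] := sa _ uo.
have leaf : forall c, c != root -> par c = u -> c \in o.
  by apply: degree_le1; rewrite -?du ?d1.
have e5 : nmem st 5 u = par u by rewrite nu /nbr_sum remaining_leaf.
have e2 : rmem st 2 u = wt u by rewrite wu /wt_sum remaining_leaf.
have pu := par_neq ur; have pu' : (nat_of_ord (par u) == u) = false.
  by rewrite val_eqE (negPf pu).
(* A stripped parent would have had its child u stripped before it. *)
have po : par u \notin o.
  apply/negP => h; have hj : (index (par u) o < size o)%N by rewrite index_mem.
  have := sc _ u hj ur; rewrite nth_index // => /(_ erefl) /mem_take.
  by rewrite (negPf uo).
set st' := sem _ _.
have s4 (v : nat) : nmem st' 4 v = if v == par u then (nmem st 4 (par u) - 1)%N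
    else if v == u then 0%N else nmem st 4 v.
  by rewrite /st' /= /upd /= e12 e5 pu'.
have s5 (v : nat) : nmem st' 5 v = if v == par u then (nmem st 5 (par u) - u)%N
    else nmem st 5 v.
  by rewrite /st' /= /upd /= e12 e5.
have s2 (v : nat) : rmem st' 2 v = if v == par u then rmem st 2 (par u) - wt u
    else rmem st 2 v.
  by rewrite /st' /= /upd /= e12 e5 e2.
have s6 j : nmem st' 6 j = if j == size o then val u else nmem st 6 j.
  by rewrite /st' /= /upd /= e12 sn.
have s13 : nmem st' 13 0 = (size o).+1 by rewrite /st' /= /upd /= sn addn1.
have s12 : nmem st' 12 0 = par u by rewrite /st' /= /upd /= e12 e5.
have vE (v w : V) : (nat_of_ord v == w) = (v == w) by rewrite val_eqE.
split=> //; last first.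
  move=> v /negPf vp; by rewrite s4 !vE vp; case: eqVneq.
split.
- by rewrite s13 size_rcons.
- by rewrite rcons_uniq uo.
- by rewrite mem_rcons inE negb_or eq_sym ur.
- move=> j; rewrite size_rcons ltnS leq_eqVlt s6 nth_rcons => /orP[/eqP->|lt_j].
    by rewrite eqxx ltnn.
  by rewrite lt_j ltn_eqF // so.
- move=> j c; rewrite size_rcons ltnS leq_eqVlt nth_rcons => /orP[/eqP->|lt_j] cr.
    by rewrite eqxx ltnn -cats1 take_size_cat // => /(leaf _ cr).
  by rewrite lt_j -cats1 takel_cat ?(ltnW lt_j) //; apply: sc.
- move=> v; rewrite mem_rcons inE negb_or => /andP[vu vo].
  have [d n w] := sa _ vo; rewrite s4 s5 s2 !vE (negPf vu).
  case: (eqVneq v (par u)) => [evp|vp].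
    rewrite -evp d n w /degree /nbr_sum /wt_sum evp !(remaining_rcons _ _ ur uo).
    by split; [rewrite addKn|rewrite addKn|rewrite addrC addKr].
  by rewrite d n w /degree /nbr_sum /wt_sum !remaining_rcons_neq.
- move=> v; rewrite mem_rcons inE s4 s5 s2 !vE => /predU1P[->|vo].
    by rewrite eq_sym (negPf pu) eqxx e5 e2.
  have -> : (v == par u) = false by apply: contraNF po => /eqP <-.
  have -> : (v == u) = false by apply: contraNF uo => /eqP <-.
  exact: sd.
Qed.

Lemma size_stripping o st : stripping o st -> (size o <= nv I)%N.
Proof. by move=> [_ /card_uniqP <- _ _ _ _ _]; rewrite -[X in (_ <= X)%N]card_ord max_card. Qed.

(** A deepest unstripped non-root vertex has no unstripped children, hence degree 1. *)
Lemma stripping_complete o st : stripping o st ->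
  (forall v : V, v != root -> nmem st 4 v != 1%N) ->
  forall v, v != root -> v \in o.
Proof.
move=> so h v; apply: contraTT => vo; apply/negP => vr.
pose P v := (v != root) && (v \notin o).
have Pv : P v by rewrite /P vr vo.
case: (arg_maxnP dep Pv) => u /andP[ur uo] umax.
have := h u ur; have [-> _ _] := strip_agg so uo.
rewrite /degree remaining_leaf // => c cr pc.
apply: contraT => co; have := umax c; rewrite /P cr co => /(_ isT).
by rewrite (dep_par rootedI cr) pc; lia.
Qed.

Lemma runs_strip st : input st -> aggregates [::] st -> nmem st 13 0 = 0%N ->
  runs Strip st (300 * (nv I).+1)
    (fun st' => exists2 o, stripping o st' & forall v, v != root -> v \in o).
Proof.
move=> ist agg z13.
pose Inv i (s : state R) := input s /\
  exists2 o, stripping o s & forall v : V, (v < i)%N -> v != root -> nmem s 4 v != 1%N.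
pose phi (s : state R) := (100 * (nv I - nmem s 13 0))%N.
apply: (@runs_for R 11 _ _ st _ (nv I) 100 Inv phi).
- split; first by case: ist.
  by exists [::] => //; split.
- by move=> i s _ [/input_n].
- move=> i s lt_i [si [o so ho]] e11.
  (* While the chain of parents is followed, the current vertex u is the only one up to i, the root
     aside, that may be a leaf. *)
  pose Jnv (s' : state R) := [/\ input s', nmem s' 11 0 = i &
    exists o (u : V), [/\ stripping o s', nmem s' 12 0 = u &
    forall v : V, (v <= i)%N -> v != u -> v != root -> nmem s' 4 v != 1%N]].
  pose s0 := sem (NAssign 12 (NVar 11)) s.
  have s0i : input s0 by case: si.
  have s0o : stripping o s0 by case: so.
  have := @runs_while R Strippable StripVertex s0 Jnv phi
    (fun s' => [/\ input s', nmem s' 11 0 = i & exists2 o, stripping o s' &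
       forall v : V, (v <= i)%N -> v != root -> nmem s' 4 v != 1%N]).
  case.
  + split=> //; exists o, (Ordinal lt_i); split=> // v le_v vi vr.
    apply: (ho _ _ vr); rewrite ltn_neqAle le_v andbT.
    by apply: contraNneq vi => e; apply/eqP; apply: val_inj; rewrite /= e.
  + move=> s1 [s1i e11' [o1 [u [so1 e12 ho1]]]].
    rewrite (beval_Strippable s1i e12) => /andP[/eqP d1 ur].
    have [uo so2 e12' hd] := strip_vertex so1 ur e12 d1.
    exists (straight_cost StripVertex); apply: runs_straight => //.
    have s2i := input_frame (sem_frame s1 (c := StripVertex) isT) isT isT s1i.
    have e13' : nmem (sem StripVertex s1) 11 0 = i by [].
    split.
      split=> //; exists (rcons o1 u), (par u); split=> // v le_v vp vr.
      apply/eqP => /(hd _ vp)[h vu]; have := ho1 v le_v vu vr.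
      by rewrite h.
    have := size_stripping so2; have := strip_n so2; have := strip_n so1.
    by rewrite /phi size_rcons => -> ->; rewrite [bcost _]/= [straight_cost _]/=; lia.
  + move=> s1 [s1i e11' [o1 [u [so1 e12 ho1]]]].
    rewrite (beval_Strippable s1i e12) negb_and negbK => hu.
    split=> //; exists o1 => // v le_v vr.
    have [evu|vu] := eqVneq v u; last exact: ho1.
    by rewrite evu; case/orP: hu => // uroot; move: vr; rewrite evu uroot.
  move=> m hm; exists (4 + m)%N.
  apply: (runs_seq (Q1 := fun s' => s' = s0)); first by apply: runs_straight.
  move=> _ ->; apply: (runs_weaken hm) => // s1 [[s1i e11' [o1 so1 ho1]] le_m].
  split=> //.
    split; first by case: s1i.
    by exists o1; [case: so1|move=> v lt_v; apply: ho1].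
  by move: le_m; rewrite /phi /= /upd /=; lia.
- move=> s [si [o so ho]]; exists o => //.
  by apply: (stripping_complete so) => v vr; apply: ho.
by rewrite /phi /= /upd /= z13; lia.
Qed.

End TreePhase.

(** * Distances and projections *)

Section DistancePhase.
Context (R : realType) (I : instance R).
Notation V := 'I_(nv I).
Context (par : V -> V) (dep : V -> nat) (wt : V -> R) (child : V * V * R -> V).
Notation root := (src I).
Notation goal := (dst I).
Hypotheses (rootedI : rooted root par dep wt child).
Notation dist := (dist par dep wt).
Notation onpath := (onpath par dep).
Notation along := (along par dep wt).
Notation away := (away par dep wt).
Notation stripping := (stripping par wt).

(** The ancestors of the goal differ in depth and so are distinct vertices; this makes [Mark]
    linear. *)
Lemma dep_goal_lt : (dep goal < nv I)%N.
Proof.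
pose f (j : 'I_(dep goal).+1) : V := iter j par goal.
suff /leq_card : injective f by rewrite !card_ord.
move=> j j' /(congr1 dep); have lt_j := ltn_ord j; have lt_j' := ltn_ord j'.
rewrite /f (dep_iter rootedI lt_j) (dep_iter rootedI lt_j') => e.
by apply: val_inj => /=; lia.
Qed.

Definition MarkStep : cmd :=
  Seq (NSet 7 (NVar 12) (NNum 1)) (NAssign 12 (NGet 5 (NVar 12))).

Definition Mark : cmd :=
  Seq (NAssign 12 (NGet 0 (NNum 4)))
      (While (BNot (EqN (NVar 12) (NGet 0 (NNum 3)))) MarkStep).

Definition marks (st : state R) : Prop := forall v : V, nmem st 7 v = onpath v.

Lemma runs_mark st : input I st ->
  (forall v : V, v != root -> nmem st 5 v = par v) ->
  (forall j, nmem st 7 j = 0%N) ->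
  runs Mark st (100 * (nv I).+1) marks.
Proof.
move=> ist h5 z7.
pose Inv (s : state R) := [/\ input I s, forall v : V, v != root -> nmem s 5 v = par v
  & exists m, [/\ (m <= dep goal)%N, nmem s 12 0 = iter m par goal
      & forall v : V, nmem s 7 v = (v \in traject par goal m)]].
(* The cell holds a natural number; [insub] recovers the vertex, whose depth counts the remaining
   rounds. *)
pose phi (s : state R) := (50 * oapp dep 0 (insub (nmem s 12 0)))%N.
pose s0 := sem (NAssign 12 (NGet 0 (NNum 4))) st.
have e0 : nmem s0 12 0 = goal by rewrite /s0 /= /upd /= (input_t ist).
have phiE s (u : V) : nmem s 12 0 = u -> phi s = (50 * dep u)%N.
  by rewrite /phi => ->; rewrite valK.
have bE s (u : V) : input I s -> nmem s 12 0 = u ->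
    beval s (BNot (EqN (NVar 12) (NGet 0 (NNum 3)))) = (u != root).
  move=> hs e; rewrite -[beval _ _]/(~~ beval s (EqN _ _)) beval_EqN /= e.
  by rewrite (input_s hs) val_eqE.
have := @runs_while R (BNot (EqN (NVar 12) (NGet 0 (NNum 3)))) MarkStep s0 Inv phi marks.
case.
- split; [by case: ist|by []|exists 0%N; split=> // v].
  exact: z7.
- move=> s [hs s5 [m [le_m e12 s7]]]; rewrite (bE _ _ hs e12) => ur.
  exists (straight_cost MarkStep); apply: runs_straight => //.
  have lt_m : (m < dep goal)%N.
    rewrite ltn_neqAle le_m andbT; apply/eqP => e.
    by have := dep_iter rootedI le_m; rewrite (dep_par rootedI ur) e; lia.
  have e12' : nmem (sem MarkStep s) 12 0 = par (iter m par goal).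
    by rewrite /= /upd /= e12 s5.
  have s7' (v : nat) : nmem (sem MarkStep s) 7 v =
      if v == iter m par goal then 1%N else nmem s 7 v.
    by rewrite /= /upd /= e12.
  have hs' := input_frame (sem_frame s (c := MarkStep) isT) isT isT hs.
  split; last first.
    rewrite (phiE _ _ e12') (phiE _ _ e12) (dep_par rootedI ur) mulnS.
    by rewrite [bcost _]/= [straight_cost _]/=; lia.
  split=> //; exists m.+1; split=> // v.
  rewrite s7' trajectSr mem_rcons inE s7 val_eqE.
  by case: eqP.
- move=> s [hs s5 [m [le_m e12 s7]]]; rewrite (bE _ _ hs e12) negbK => /eqP ur v.
  have := dep_iter rootedI le_m; rewrite ur (dep_root rootedI) => hm.
  by rewrite s7; have -> : m = dep goal by lia.
move=> m [s [T [ex le_T [q le_m]]]].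
have dg := dep_goal_lt; rewrite (_ : 100 * _ = 6 + (100 * (nv I).+1 - 6))%N; last lia.
apply: (runs_seq (Q1 := fun s' => s' = s0)); first by apply: runs_straight.
move=> _ ->; exists s, T; split=> //.
by move: le_m; rewrite (phiE _ _ e0) [bcost _]/=; lia.
Qed.

(** The stripping order is read from its last entry, at index size minus 1, so that parents come
    first. The root, never stripped, relies on cells that are initially 0. *)
Definition TopDownStep : cmd :=
  let u := NVar 12 in
  Seq (NAssign 12 (NGet 6 (NSub (NSub (NVar 13) (NNum 1)) (NVar 11))))
  (Seq (RSet 3 u (RAdd (RGet 3 (NGet 5 u)) (RGet 2 u)))
       (If (BLeN (NNum 1) (NGet 7 u)) (RSet 4 u (RGet 3 u))
           (RSet 4 u (RGet 4 (NGet 5 u))))).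

Definition TopDown : cmd := For 11 (NVar 13) TopDownStep.

Definition distances (st : state R) : Prop :=
  forall v : V, rmem st 3 v = dist v /\ rmem st 4 v = along v.

Lemma runs_topdown st o : stripping o st ->
  (forall v, v != root -> v \in o) -> marks st ->
  (forall j, rmem st 3 j = 0) -> (forall j, rmem st 4 j = 0) ->
  runs TopDown st (200 * (nv I).+1) distances.
Proof.
move=> so full ms z3 z4.
pose Inv i (s : state R) := [/\ stripping o s, marks s & forall v : V,
  v = root \/ (size o - i <= index v o < size o)%N ->
  rmem s 3 v = dist v /\ rmem s 4 v = along v].
have sz := size_stripping so.
apply: (@runs_for R 11 _ _ st _ (size o) 100 Inv (fun=> 0%N)).
- split; [by case: so|by []|move=> v []]; last by lia.
  move=> ->; rewrite (dist_root rootedI) (along_root rootedI).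
  by split; [apply: z3|apply: z4].
- by move=> i s _ [/strip_n].
- move=> i s lt_i [sos mss hd] e11; exists (straight_cost TopDownStep).
  apply: runs_straight => //.
  pose j := (size o - 1 - i)%N; have lt_j : (j < size o)%N by rewrite /j; lia.
  pose u := nth root o j.
  have uo : u \in o by rewrite mem_nth.
  have ur : u != root by apply: contraNneq (strip_root so) => <-.
  have eu : nmem s 6 j = u by rewrite (strip_order sos).
  have iu : index u o = j by rewrite index_uniq // (strip_uniq so).
  have [_ e5 e2] := strip_done sos uo.
  have e13 := strip_n sos.
  have hp : rmem s 3 (par u) = dist (par u) /\ rmem s 4 (par u) = along (par u).
    apply: hd; have [->|pr] := eqVneq (par u) root; [by left|right].
    have po := full _ pr; have lt_p : (index (par u) o < size o)%N by rewrite index_mem.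
    have := strip_children so lt_p ur; rewrite nth_index // => /(_ erefl).
    by rewrite in_take // iu /j; lia.
  case: hp => p3 p4.
  set s1 := sem TopDownStep s.
  have r3 (v : nat) : rmem s1 3 v = if v == u then dist u else rmem s 3 v.
    rewrite (dist_par rootedI ur) -p3 -e2 /s1 /= /upd /= e13 e11 eu e5.
    by case: ifP.
  have r4 (v : nat) : rmem s1 4 v = if v == u then along u else rmem s 4 v.
    rewrite /s1 /= /upd /= e13 e11 eu e5 mss p4 p3 e2 eqxx.
    have := along_par rootedI ur; case: (boolP (onpath u)) => /= [hu _|hu ->];
      last by rewrite addr0.
    by rewrite along_onpath // (dist_par rootedI ur).
  have fr := sem_frame s (c := TopDownStep) isT.
  have sos1 := stripping_frame fr isT isT sos.
  have mss1 : marks s1 by move=> v; rewrite fr.1.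
  have e11' : nmem s1 11 0 = i by rewrite fr.1.
  split=> //; split; [by case: sos1|by []|move=> v hv].
  rewrite -[rmem (sem (Incr 11) s1)]/(rmem s1) r3 r4 val_eqE.
  case: eqVneq => [->//|vu]; apply: hd.
  case: hv => [->|/andP[le_v lt_v]]; [by left|right].
  rewrite lt_v andbT.
  have vo : v \in o by rewrite -index_mem.
  have : index v o != j.
    by apply: contraNneq vu => e; rewrite /u -e nth_index.
  by move: le_v; rewrite /j; lia.
- move=> s [_ _ hd] v; apply: hd; have [->|vr] := eqVneq v root; [by left|right].
  by rewrite subnn index_mem full.
by rewrite /=; lia.
Qed.

Definition AgentStep : cmd :=
  let i := NVar 11 in let p := NVar 15 in
  let h := RSub (RGet 3 p) (RGet 4 p) in
  let x := RAdd (RGet 4 p) (RGet 4 p) in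
  Seq (NAssign 15 (NGet 3 i))
  (Seq (RSet 7 i (RSub (RSub (RGet 1 i) h) h))
  (Seq (RSet 5 i (RSub x (RGet 7 i))) (RSet 6 i (RAdd x (RGet 7 i))))).

Definition Agents : cmd := For 11 (NGet 0 (NNum 2)) AgentStep.

Definition carriers (n : nat) (st : state R) : Prop :=
  forall i : 'I_(nag I), (i < n)%N ->
  let x := carrier_pos par dep wt i in let b := carrier_range par dep wt i in
  [/\ rmem st 5 i = x - b, rmem st 6 i = x + b & rmem st 7 i = b].

Lemma runs_agents st : input I st -> distances st ->
  runs Agents st (200 * (nag I).+1) (carriers (nag I)).
Proof.
move=> ist hd.
pose Inv i (s : state R) := [/\ input I s, distances s & carriers i s].
apply: (@runs_for R 11 _ _ st _ (nag I) 100 Inv (fun=> 0%N)).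
- by split; [case: ist|by []|move=> i].
- by move=> i s _ [/input_k].
- move=> i s lt_i [hs hds hc] e11; exists (straight_cost AgentStep).
  apply: runs_straight => //.
  have [ep eb] := input_agent hs (Ordinal lt_i).
  have [d1 d2] := hds (pos (Ordinal lt_i)).
  rewrite /= in ep eb.
  set b := carrier_range par dep wt (Ordinal lt_i).
  set x := carrier_pos par dep wt (Ordinal lt_i).
  set s1 := sem AgentStep s.
  have r7 (j : nat) : rmem s1 7 j = if j == i then b else rmem s 7 j.
    by rewrite /s1 /= /upd /= e11 ep eb d1 d2.
  have r5 (j : nat) : rmem s1 5 j = if j == i then x - b else rmem s 5 j.
    by rewrite /s1 /= /upd /= e11 ep eb d1 d2 eqxx.
  have r6 (j : nat) : rmem s1 6 j = if j == i then x + b else rmem s 6 j.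
    by rewrite /s1 /= /upd /= e11 ep eb d1 d2 eqxx.
  split=> //; split; [by case: hs|by []|move=> k].
  rewrite ltnS leq_eqVlt => hk.
  rewrite -[rmem (sem (Incr 11) s1)]/(rmem s1) r7 r5 r6.
  have [eki|nki] := eqVneq (nat_of_ord k) i.
    by have -> : k = Ordinal lt_i by exact: val_inj.
  by apply: hc; move: hk; rewrite (negPf nki).
- by move=> s [].
by rewrite /=; lia.
Qed.

Definition Survey : cmd :=
  Seq Aggregate (Seq Strip (Seq Mark (Seq TopDown Agents))).

Lemma size_edges_le : (size (edges I) <= nv I)%N.
Proof.
have /perm_size := child_perm rootedI; rewrite size_map => ->.
by rewrite size_filter -[X in (_ <= X)%N]size_enum_ord count_size.
Qed.

Lemma load_input : input I (load I).
Proof.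
split=> // [x0 j lt_j|i]; first by rewrite /= !(nth_map x0).
split; rewrite [LHS](nth_map i) ?size_enum_ord //; first by rewrite nth_ord_enum.
by rewrite nth_ord_enum.
Qed.

Lemma load_nmem a j : (3 < a)%N -> nmem (load I) a j = 0%N.
Proof. by case: a => [|[|[|[|[|a]]]]] //= _; rewrite ?nth_nil. Qed.

Lemma load_rmem a j : (1 < a)%N -> rmem (load I) a j = 0.
Proof. by case: a => [|[|[|a]]] //= _; rewrite ?nth_nil. Qed.

Lemma runs_survey :
  runs Survey (load I) (1000 * (nv I + nag I).+1)
    (fun st => [/\ input I st, distances st & carriers (nag I) st]).
Proof.
have i0 := load_input; have zn := load_nmem; have zr := load_rmem.
have sz := size_edges_le.
apply: (@runs_weaken _ _ _ (200 * (size (edges I)).+1 + (300 * (nv I).+1 +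
  (100 * (nv I).+1 + (200 * (nv I).+1 + 200 * (nag I).+1))))%N); [|lia|by move=> s; exact].
have agg := runs_aggregate rootedI i0 (zn 4 ^~ isT) (zn 5 ^~ isT) (zr 2 ^~ isT).
apply: (runs_seq (runs_frame agg)) => s1 [{}agg fr1].
have i1 := input_frame fr1 isT isT i0.
have z1 : nmem s1 13 0 = 0%N by rewrite fr1.1 // zn.
apply: (runs_seq (runs_frame (runs_strip rootedI i1 agg z1))) => s2 [[o so full] fr2].
have i2 := input_frame fr2 isT isT i1.
have p2 (v : V) : v != root -> nmem s2 5 v = par v.
  by move=> /full /(strip_done so)[].
have z2 j : nmem s2 7 j = 0%N by rewrite fr2.1 // fr1.1 // zn.
apply: (runs_seq (runs_frame (runs_mark i2 p2 z2))) => s3 [ms fr3].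
have i3 := input_frame fr3 isT isT i2.
have so3 := stripping_frame fr3 isT isT so.
have z3 a j : (2 < a < 5)%N -> rmem s3 a j = 0.
  case: a => [|[|[|[|[|a]]]]] // _; by rewrite fr3.2 // fr2.2 // fr1.2 // zr.
apply: (runs_seq (runs_frame (runs_topdown so3 full ms (z3 3 ^~ isT) (z3 4 ^~ isT))))
  => s4 [ds fr4].
have i4 := input_frame fr4 isT isT i3.
apply: (runs_weaken (runs_frame (runs_agents i4 ds))) => // s5 [cs fr5].
split=> //; first exact: input_frame fr5 isT isT i4.
by move=> v; rewrite !fr5.2.
Qed.

End DistancePhase.

(** * The greedy loop *)

Lemma tournament_ext (R : realType) K (key key' : nat -> R) T T' (S S' : pred nat) q :
  (forall j, key' j = key j) -> (forall j, T' j = T j) ->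
  (forall j, (j < K)%N -> S' j = S j) ->
  tournament K key T S q -> tournament K key' T' S' q.
Proof.
move=> ek eT eS [h1 h2 h3]; split=> [i lt_i|p hp np|K0].
- by rewrite eT h1 // eS.
- by rewrite !eT h2 // /winner !ek.
by rewrite eT h3.
Qed.

Section GreedyPhase.
Context (R : realType) (k : nat) (x b : 'I_k -> R).
Notation advance := (advance x b).
Notation coverable := (coverable x b).

Record ready (st : state R) : Prop := Ready {
  ready_k : nmem st 0 2 = k;
  ready_keys : forall i : 'I_k, [/\ rmem st 5 i = x i - b i,
    rmem st 6 i = x i + b i & rmem st 7 i = b i] }.

Lemma ready_frame ns rs st st' : agree_outside ns rs st st' -> 0%N \notin ns ->
  all (fun a => a \notin rs) [:: 5; 6; 7]%N -> ready st -> ready st'.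
Proof.
move=> [hn hr] n0 /and4P[r5 r6 r7 _] [h1 h2]; split; rewrite ?hn // => i.
by rewrite !hr.
Qed.

Definition natset (A : {set 'I_k}) : pred nat :=
  fun j => if insub j is Some i then i \in A else false.

Lemma natset_val A (i : 'I_k) : natset A i = (i \in A).
Proof. by rewrite /natset valK. Qed.

Definition HalveStep : cmd :=
  let i := NVar 11 in
  Seq (NSet 8 (NAdd i i) i) (NSet 8 (NAdd (NAdd i i) (NNum 1)) i).

Definition Halve : cmd := For 11 (NGet 0 (NNum 2)) HalveStep.

Lemma runs_halve st : ready st ->
  runs Halve st (200 * k.+1) (fun st' => halves k (nmem st' 8)).
Proof.
move=> rst.
pose Inv i (s : state R) := ready s /\ halves i (nmem s 8).
apply: (@runs_for R 11 _ _ st _ k 100 Inv (fun=> 0%N)).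
- by split; [case: rst|].
- by move=> i s _ [/ready_k].
- move=> i s lt_i [rs hs] e11; exists (straight_cost HalveStep).
  apply: runs_straight => //.
  set s1 := sem HalveStep s.
  have e8 j : nmem s1 8 j = if j == (i + i + 1)%N then i else
      if j == (i + i)%N then i else nmem s 8 j.
    by rewrite /s1 /= /upd /= e11.
  split=> //; split; first by case: rs.
  rewrite -[nmem (sem (Incr 11) s1) 8]/(nmem s1 8) => p; rewrite ltnS leq_eqVlt => /orP[/eqP->|lt_p].
    by rewrite !e8 !eqxx; case: ifP.
  have [h1 h2] := hs p lt_p.
  by rewrite !e8 !ifN_eq //; lia.
- by move=> s [].
by rewrite /=; lia.
Qed.

Definition update_cost : nat := (100 * trunc_log 2 k + 220)%N.

Definition Fill : cmd :=
  For 11 (NGet 0 (NNum 2))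
    (Update 9 5 (NAdd (NGet 0 (NNum 2)) (NVar 11)) (NAdd (NVar 11) (NNum 1))).

Lemma tournament0 (key : nat -> R) (T : nat -> nat) :
  (forall j, T j = 0%N) -> tournament k key T (fun=> false) 0.
Proof. by move=> T0; split=> // *; rewrite !T0. Qed.

Lemma runs_fill st : ready st -> halves k (nmem st 8) ->
  (forall j, nmem st 9 j = 0%N) ->
  runs Fill st (k * (update_cost + 100) + 20)
    (fun st' => tournament k (rmem st' 5) (nmem st' 9) (natset [set: 'I_k]) 0).
Proof.
move=> rst hst z9.
pose Inv i (s : state R) := [/\ ready s, halves k (nmem s 8) &
  tournament k (rmem s 5) (nmem s 9) (fun j => (j < i)%N) 0].
apply: (@runs_for R 11 _ _ st _ k update_cost Inv (fun=> 0%N)).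
- by split; [case: rst|by []|apply: tournament0].
- by move=> i s _ [/ready_k].
- move=> i s lt_i [rs hs ts] e11; exists update_cost.
  have ek := ready_k rs.
  have ev : neval (sem (NAssign 15 (NAdd (NGet 0 (NNum 2)) (NVar 11))) s)
      (NAdd (NVar 11) (NNum 1)) = i.+1 by rewrite /= /upd /= e11 addn1.
  have ep : neval s (NAdd (NGet 0 (NNum 2)) (NVar 11)) = (k + i)%N.
    by rewrite /= ek e11.
  have := @runs_update R 9 5 _ _ s k _ i _ true isT isT hs ts lt_i ep ev erefl.
  move=> /runs_frame hr; apply: (runs_weaken hr).
    by rewrite /update_cost /=; lia.
  move=> s1 [ts1 fr]; split=> //; first by rewrite fr.1.
  split; first by case: (ready_frame fr isT isT rs).
    by move=> p lt_p; rewrite -[nmem (sem (Incr 11) s1) 8]/(nmem s1 8) !fr.1 //; apply: hs.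
  apply: tournament_ext ts1 => // j lt_j /=.
  by rewrite ltnS leq_eqVlt; case: eqP.
- move=> s [_ _ ts]; apply: tournament_ext ts => // j lt_j.
  by rewrite -[j]/(val (Ordinal lt_j)) natset_val inE.
by rewrite /=; lia.
Qed.

Lemma natsetU1 A (i : 'I_k) j : (j < k)%N ->
  natset (i |: A) j = if j == i then true else natset A j.
Proof.
move=> lt_j; rewrite -[j]/(val (Ordinal lt_j)) !natset_val !inE -val_eqE /=.
by case: eqP.
Qed.

Lemma natsetD1 A (i : 'I_k) j : (j < k)%N ->
  natset (A :\ i) j = if j == i then false else natset A j.
Proof.
move=> lt_j; rewrite -[j]/(val (Ordinal lt_j)) !natset_val !inE -val_eqE /=.
by case: eqP.
Qed.

Lemma tournament_min (key : nat -> R) T A j : tournament k key T (natset A) 0 -> T 1%N = j.+1 ->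
  exists i : 'I_k, [/\ j = i, i \in A & forall i', i' \in A -> key i <= key i'].
Proof.
move=> /tournament_top[_ h] /h[lt_j Aj le_key]; exists (Ordinal lt_j); split=> //.
  by rewrite -natset_val.
by move=> i' Ai'; apply: le_key => //; rewrite natset_val.
Qed.

Lemma tournament_empty (key : nat -> R) T A : tournament k key T (natset A) 0 -> T 1%N = 0%N ->
  A = set0.
Proof.
move=> /tournament_top[h _] /h none; apply/setP => i; rewrite inE.
by have := none i (ltn_ord i); rewrite natset_val => /negPf.
Qed.

(** Counted from the memory rather than from the sets in the invariant, because a potential is a
    function of the state. *)
Definition occupied (t : nat) (st : state R) : nat :=
  #|[pred i : 'I_k | nmem st t (k + i)%N != 0%N]|.

Lemma occupiedE t st key A :
  @tournament R k key (nmem st t) (natset A) 0 -> occupied t st = #|A|.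
Proof.
move=> [leaves _ _]; apply: eq_card => i.
by rewrite !inE leaves // natset_val; case: (i \in A).
Qed.

Definition Advance : cmd :=
  let i := NSub (NVar 16) (NNum 1) in
  Seq (RAssign 9 (RAdd (RVar 8) (RGet 7 i)))
  (Seq (If (BLeR (RGet 6 i) (RVar 9)) (RAssign 9 (RGet 6 i)) Skip)
       (If (BLeR (RVar 8) (RVar 9)) (RAssign 8 (RVar 9)) Skip)).

Lemma sem_advance st (i : 'I_k) : ready st -> nmem st 16 0 = i.+1 ->
  x i - b i <= rmem st 8 0 ->
  rmem (sem Advance st) 8 0 = advance i (rmem st 8 0).
Proof.
move=> [_ /(_ i)[_ r6 r7]] e16 ri.
rewrite /advance ri /Advance /= /upd /= e16 subn1 /= r6 r7.
rewrite maxEle minElt.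
by have [le1|gt1] := leP (x i + b i) (rmem st 8 0 + b i) => /=; case: ifP.
Qed.

Definition Released : bexp :=
  BAnd (BLeN (NNum 1) (NGet 9 (NNum 1)))
       (BLeR (RGet 5 (NSub (NGet 9 (NNum 1)) (NNum 1))) (RVar 8)).

(** The target length does not occur: serving more agents never lowers the covered length, so the
    loop runs until nobody is available and [Verdict] compares afterwards. *)
Definition GreedyStep : cmd :=
  let leaf := NAdd (NGet 0 (NNum 2)) (NSub (NVar 16) (NNum 1)) in
  If Released
    (Seq (NAssign 16 (NGet 9 (NNum 1)))
    (Seq (Update 9 5 leaf (NNum 0)) (Update 10 6 leaf (NVar 16))))
    (If (BLeN (NNum 1) (NGet 10 (NNum 1)))
      (Seq (NAssign 16 (NGet 10 (NNum 1)))
      (Seq (Update 10 6 leaf (NNum 0)) Advance))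
      (NAssign 14 (NNum 0))).

Definition Greedy : cmd :=
  Seq (NAssign 14 (NNum 1)) (While (BLeN (NNum 1) (NVar 14)) GreedyStep).

Section Step.
Context (l : R).

(** [A1] waits for release, [A2] is available. Flag 0 means that no remaining agent is available,
    which is the situation of [coverable_unavailable]. *)
Definition greedy_inv (st : state R) : Prop :=
  ready st /\ halves k (nmem st 8) /\ exists A1 A2 : {set 'I_k},
  [/\ [disjoint A1 & A2],
      tournament k (rmem st 5) (nmem st 9) (natset A1) 0,
      tournament k (rmem st 6) (nmem st 10) (natset A2) 0,
      forall i, i \in A2 -> x i - b i <= rmem st 8 0 &
      (coverable l (rmem st 8 0) (A1 :|: A2) <-> coverable l 0 [set: 'I_k]) /\
      (nmem st 14 0 = 0%N -> forall i, i \in A1 :|: A2 -> rmem st 8 0 < x i - b i)].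

(** An agent counts 2 in the first tree and 1 in the second, so that a transfer and a use each free
    one unit, enough for two updates; the flag pays for the round that clears it. *)
Definition greedy_pot (st : state R) : nat :=
  ((2 * update_cost + 300) * (2 * occupied 9 st + occupied 10 st + nmem st 14 0))%N.

Lemma runs_greedy_step st : greedy_inv st -> (0 < nmem st 14 0)%N ->
  exists m, runs GreedyStep st m (fun st' => greedy_inv st' /\
     (bcost (BLeN (NNum 1) (NVar 14)) + m + greedy_pot st' <= greedy_pot st)%N).
Proof.
move=> [rs [hs [A1 [A2 [dis t1 t2 rel [cov _]]]]]] on.
set c := rmem st 8 0 in rel cov.
have ek := ready_k rs.
have o1 := occupiedE t1; have o2 := occupiedE t2.
have [released|unreleased] := boolP (beval st Released).
  have [j e9] : exists j, nmem st 9 1 = j.+1.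
    by move: released => /= /andP[]; case: (nmem st 9 1) => // j; exists j.
  have [i [ej iA1 _]] := tournament_min t1 e9; subst j.
  have rel_i : x i - b i <= c.
    move: released => /= /andP[_]; rewrite e9 subn1 /=.
    by have [-> _ _] := ready_keys rs i.
  have iA2 : i \notin A2 by rewrite (disjointFr dis iA1).
  (* The 200 of [runs_update], plus 7 for the leaf index and at most 2 for the stored value. *)
  pose u := (100 * trunc_log 2 k + 209)%N.
  exists (bcost Released + (5 + (u + u)))%N; apply: runs_if; rewrite released.
  pose s1 := sem (NAssign 16 (NGet 9 (NNum 1))) st.
  apply: (runs_seq (Q1 := fun s' => s' = s1)); first by apply: runs_straight.
  move=> _ ->.
  have e16 : nmem s1 16 0 = i.+1 by rewrite /s1 /= /upd /= e9.
  have leafE (s : state R) : nmem s 0 2 = k -> nmem s 16 0 = i.+1 ->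
      neval s (NAdd (NGet 0 (NNum 2)) (NSub (NVar 16) (NNum 1))) = (k + i)%N.
    by move=> h1 h2 /=; rewrite h1 h2 subn1.
  have rs1 : ready s1 by case: rs.
  have hs1 : halves k (nmem s1 8) by [].
  have t11 : tournament k (rmem s1 5) (nmem s1 9) (natset A1) 0 by [].
  have up1 := @runs_update R 9 5 _ (NNum 0) s1 k _ i _ false isT isT hs1 t11
    (ltn_ord i) (leafE _ (ready_k rs1) e16) erefl erefl.
  apply: (runs_seq (n1 := u) (runs_weaken (runs_frame up1) _ (fun _ h => h))).
    by rewrite /u /=; lia.
  move=> s2 [t12 fr2].
  have rs2 := ready_frame fr2 isT isT rs1.
  have hs2 : halves k (nmem s2 8) by move=> p lt_p; rewrite !fr2.1 //; apply: hs.
  have e16' : nmem s2 16 0 = i.+1 by rewrite fr2.1.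
  have t22 : tournament k (rmem s2 6) (nmem s2 10) (natset A2) 0.
    by apply: tournament_ext t2 => // j; rewrite ?fr2.1 ?fr2.2.
  have ev : neval (sem (NAssign 15 (NAdd (NGet 0 (NNum 2)) (NSub (NVar 16) (NNum 1)))) s2)
     (NVar 16) = i.+1 by exact: e16'.
  have up2 := @runs_update R 10 6 _ (NVar 16) s2 k _ i _ true isT isT hs2 t22
    (ltn_ord i) (leafE _ (ready_k rs2) e16') ev erefl.
  apply: (runs_weaken (runs_frame up2)); first by rewrite /u /=; lia.
  move=> s3 [t23 fr3].
  have rs3 := ready_frame fr3 isT isT rs2.
  have hs3 : halves k (nmem s3 8) by move=> p lt_p; rewrite !fr3.1 //; apply: hs2.
  have e8 : rmem s3 8 0 = c by rewrite fr3.2 // fr2.2.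
  have e14 : nmem s3 14 0 = nmem st 14 0 by rewrite fr3.1 // fr2.1.
  have t13 : tournament k (rmem s3 5) (nmem s3 9) (natset (A1 :\ i)) 0.
    apply: tournament_ext t12 => j; rewrite ?fr3.1 ?fr3.2 //.
    exact: natsetD1.
  have t33 : tournament k (rmem s3 6) (nmem s3 10) (natset (i |: A2)) 0.
    by apply: tournament_ext t23 => // j; exact: natsetU1.
  split; last first.
    rewrite /greedy_pot (occupiedE t13) (occupiedE t33) e14 o1 o2.
    have -> : (2 * #|A1| + #|A2| = (2 * #|A1 :\ i| + #|i |: A2|).+1)%N.
      by rewrite (cardsD1 i A1) iA1 cardsU1 iA2 /= !add1n mulnS addnS !addSn.
    rewrite addSn mulnS leq_add2r /u /update_cost [bcost _]/= [bcost _]/=.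
    by lia.
  split=> //; split=> //; exists (A1 :\ i), (i |: A2).
  have eU : (A1 :\ i) :|: (i |: A2) = A1 :|: A2.
    by apply/setP => j; rewrite !inE; case: eqVneq => [->|]; rewrite ?iA1.
  rewrite eU e8 e14; split=> //.
  - rewrite -setI_eq0; apply/eqP/setP => j; rewrite !inE.
    by case: eqP => //= _; rewrite andbC; case: (boolP (j \in A2)) => //= /(disjointFl dis) ->.
  - by move=> j; rewrite !inE => /predU1P[->|/rel].
  - by split=> // e; rewrite e in on.
have late i : i \in A1 -> c < x i - b i.
  move=> iA1; rewrite ltNge; apply: contra unreleased => le_i /=.
  case e9: (nmem st 9 1) => [|j]; first by rewrite (tournament_empty t1 e9) inE in iA1.
  have [i' [-> i'A1 min_i']] := tournament_min t1 e9.
  rewrite subn1 /=; apply: le_trans (min_i' _ iA1) _.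
  by have [-> _ _] := ready_keys rs i.
case e10: (nmem st 10 1) => [|j].
  exists (bcost Released + (bcost (BLeN (NNum 1) (NGet 10 (NNum 1))) + 3))%N.
  apply: runs_if; rewrite (negPf unreleased); apply: runs_if.
  rewrite /= e10 /=; apply: runs_straight => //.
  set s1 := sem _ st.
  split; last first.
    rewrite /greedy_pot -[occupied 9 s1]/(occupied 9 st).
    rewrite -[occupied 10 s1]/(occupied 10 st) -[nmem s1 14 0]/0%N.
    have leF := leq_pmulr (2 * update_cost + 300) on.
    by rewrite addn0 [X in (_ <= X)%N]mulnDr /=; lia.
  split; first by case: rs.
  split=> //; exists A1, A2; split=> //; split=> // _ i.
  by rewrite (tournament_empty t2 e10) setU0; exact: late.
have [i [ej iA2 min_i]] := tournament_min t2 e10; subst j.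
have iA1 : i \notin A1 by rewrite (disjointFl dis iA2).
pose u := (100 * trunc_log 2 k + 209)%N.
exists (bcost Released + (bcost (BLeN (NNum 1) (NGet 10 (NNum 1))) +
  (5 + (u + straight_cost Advance))))%N.
apply: runs_if; rewrite (negPf unreleased); apply: runs_if.
rewrite [beval _ _]/= e10 /=.
pose s1 := sem (NAssign 16 (NGet 10 (NNum 1))) st.
apply: (runs_seq (Q1 := fun s' => s' = s1)); first by apply: runs_straight.
move=> _ ->.
have e16 : nmem s1 16 0 = i.+1 by rewrite /s1 /= /upd /= e10.
have rs1 : ready s1 by case: rs.
have hs1 : halves k (nmem s1 8) by [].
have t21 : tournament k (rmem s1 6) (nmem s1 10) (natset A2) 0 by [].
have leaf : neval s1 (NAdd (NGet 0 (NNum 2)) (NSub (NVar 16) (NNum 1))) = (k + i)%N.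
  by rewrite -[LHS]/(nmem s1 0 2 + (nmem s1 16 0 - 1))%N (ready_k rs1) e16 subn1.
have up1 := @runs_update R 10 6 _ (NNum 0) s1 k _ i _ false isT isT hs1 t21
  (ltn_ord i) leaf erefl erefl.
apply: (runs_seq (n1 := u) (runs_weaken (runs_frame up1) _ (fun _ h => h))).
  by rewrite /u /=; lia.
move=> s2 [t22 fr2].
have rs2 := ready_frame fr2 isT isT rs1.
have e16' : nmem s2 16 0 = i.+1 by rewrite fr2.1.
have e8' : rmem s2 8 0 = c by rewrite fr2.2.
have rel_i : x i - b i <= rmem s2 8 0 by rewrite e8' rel.
have adv := sem_advance rs2 e16' rel_i; rewrite e8' in adv.
have fr3 := sem_frame s2 (c := Advance) isT.
apply: runs_straight => //.
move: (sem Advance s2) => s3 in adv fr3 *.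
have rs3 := ready_frame fr3 isT isT rs2.
have hs3 : halves k (nmem s3 8).
  by move=> p lt_p; rewrite !fr3.1 // !fr2.1 //; apply: hs.
have e14 : nmem s3 14 0 = nmem st 14 0 by rewrite fr3.1 // fr2.1.
have t13 : tournament k (rmem s3 5) (nmem s3 9) (natset A1) 0.
  by apply: tournament_ext t1 => // j; rewrite ?fr3.1 ?fr3.2 // ?fr2.1 ?fr2.2.
have t33 : tournament k (rmem s3 6) (nmem s3 10) (natset (A2 :\ i)) 0.
  apply: tournament_ext t22 => j; rewrite ?fr3.1 ?fr3.2 //.
  exact: natsetD1.
split; last first.
  rewrite /greedy_pot (occupiedE t13) (occupiedE t33) e14 o1 o2.
  have -> : (2 * #|A1| + #|A2| = (2 * #|A1| + #|A2 :\ i|).+1)%N.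
    by rewrite (cardsD1 i A2) iA2 /= !add1n addnS.
  by rewrite addSn mulnS leq_add2r /u /update_cost /=; lia.
split=> //; split=> //; exists A1, (A2 :\ i).
have eU : A1 :|: (A2 :\ i) = (A1 :|: A2) :\ i.
  by apply/setP => j; rewrite !inE; case: eqVneq => [->|]; rewrite ?(negPf iA1).
rewrite eU adv e14; split=> //.
- by apply: disjointWr dis; apply: subD1set.
- move=> j; rewrite !inE => /andP[_ /rel le_j].
  exact: le_trans le_j (advance_ge _ _ _ _).
split; last by move=> e; rewrite e in on.
apply: iff_trans cov; apply: iff_sym; apply: coverable_earliest_deadline.
- by rewrite inE iA2 orbT.
- exact: rel.
move=> i' /setUP[/late late_i'|i'A2] rel_i'; first by lra.
have := min_i _ i'A2.
by have [_ -> _] := ready_keys rs i; have [_ -> _] := ready_keys rs i'.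
Qed.

Lemma runs_greedy st : ready st -> halves k (nmem st 8) ->
  tournament k (rmem st 5) (nmem st 9) (natset [set: 'I_k]) 0 ->
  (forall j, nmem st 10 j = 0%N) -> rmem st 8 0 = 0 ->
  runs Greedy st ((2 * update_cost + 300) * (2 * k + 2))
    (fun st' => coverable l 0 [set: 'I_k] <-> l <= rmem st' 8 0).
Proof.
move=> rs hs t1 z10 z8; set F := (2 * update_cost + 300)%N.
pose s1 := sem (NAssign 14 (NNum 1)) st.
(* The potential starts at [F * (2 * k + 1)], with all agents in the first tree and the flag set;
   the remaining F pays for the assignment and the failing test. *)
rewrite (_ : F * _ = 3 + (F * (2 * k + 2) - 3))%N; last by rewrite /F; lia.
apply: (runs_seq (Q1 := fun s' => s' = s1)); first by apply: runs_straight.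
move=> _ ->.
have t2 : tournament k (rmem st 6) (nmem st 10) (natset set0) 0.
  apply: tournament_ext (tournament0 (rmem st 6) z10) => // j lt_j.
  by rewrite -[j]/(val (Ordinal lt_j)) natset_val inE.
have := @runs_while R (BLeN (NNum 1) (NVar 14)) GreedyStep s1 greedy_inv greedy_pot
  (fun st' => coverable l 0 [set: 'I_k] <-> l <= rmem st' 8 0).
case.
- split; first by case: rs.
  split=> //; exists [set: 'I_k], set0; split=> //.
  + by rewrite -setI_eq0 setI0.
  + by move=> i; rewrite inE.
  + by rewrite setU0 -[rmem s1 8 0]/(rmem st 8 0) z8.
- by move=> s inv on; apply: runs_greedy_step.
- move=> s [_ [_ [A1 [A2 [_ _ _ _ [cov stop]]]]]] off.
  apply: iff_trans (iff_sym cov) _; apply: coverable_unavailable; apply: stop.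
  by move: off; rewrite /=; lia.
move=> m [s [T [ex le_T [q le_m]]]]; exists s, T; split=> //.
move: le_m; rewrite /greedy_pot -/F -[occupied 9 s1]/(occupied 9 st).
rewrite -[occupied 10 s1]/(occupied 10 st) (occupiedE t1) (occupiedE t2).
rewrite cardsT card_ord cards0 addn0 -[nmem s1 14 0]/1%N [bcost _]/=.
by rewrite !mulnDr; rewrite /F; lia.
Qed.

End Step.
End GreedyPhase.

(** * The decision procedure *)

Definition AnyRange : cmd :=
  Seq (NAssign 14 (NNum 0))
    (For 11 (NGet 0 (NNum 2))
      (If (BLeR (RVar 10) (RGet 7 (NVar 11))) (NAssign 14 (NNum 1)) Skip)).

Definition TwiceLength : rexp :=
  let t := NGet 0 (NNum 4) in RAdd (RGet 3 t) (RGet 3 t).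

Definition Verdict : cmd :=
  If (BLeR TwiceLength (RVar 8)) (NAssign 14 (NNum 1)) (NAssign 14 (NNum 0)).

(** The answer is copied last because its cell holds n, which [Strip] reads as its loop bound. *)
Definition Decide : cmd :=
  Seq Survey
  (Seq (If (BLeR TwiceLength (RVar 10)) AnyRange
           (Seq Halve (Seq Fill (Seq Greedy Verdict))))
       (NSet 0 (NNum 0) (NVar 14))).

Lemma runs_any_range (R : realType) k (x b : 'I_k -> R) st :
  ready x b st -> rmem st 10 0 = 0 ->
  runs AnyRange st (200 * k.+1)
    (fun st' => nmem st' 14 0 = 1%N <-> exists i, 0 <= b i).
Proof.
move=> rst z10.
pose Inv i (s : state R) := [/\ ready x b s, rmem s 10 0 = 0 &
  (nmem s 14 0 == 1%N) = [exists j : 'I_k, (j < i)%N && (0 <= b j)]].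
rewrite (_ : 200 * _ = 3 + (200 * k.+1 - 3))%N; last by lia.
pose s1 := sem (NAssign 14 (NNum 0)) st.
apply: (runs_seq (Q1 := fun s' => s' = s1)); first by apply: runs_straight.
move=> _ ->.
apply: (@runs_for R 11 _ _ s1 _ k 100 Inv (fun=> 0%N)).
- split; [by case: rst|by []|].
  by apply/esym/existsP => -[].
- by move=> i s _ [/ready_k].
- move=> i s lt_i [rs z hs] e11.
  set body := If _ _ _; exists (straight_cost body).
  apply: runs_straight => //.
  have fr := sem_frame s (c := body) isT.
  have rs1 := ready_frame fr isT isT rs.
  have e14 : nmem (sem body s) 14 0 =
      if 0 <= b (Ordinal lt_i) then 1%N else nmem s 14 0.
    have [_ _] := ready_keys rs (Ordinal lt_i); rewrite /= => r7.
    by rewrite /body /= z e11 r7; case: ifP.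
  have e11' : nmem (sem body s) 11 0 = i by rewrite fr.1.
  have z' : rmem (sem body s) 10 0 = 0 by rewrite fr.2.
  move: (sem body s) => s2 in fr rs1 e14 e11' z' *.
  split=> //; split; [by case: rs1|by []|].
  rewrite -[nmem (sem _ s2) 14 0]/(nmem s2 14 0) e14.
  case: ifP => hb.
    by apply/esym/existsP; exists (Ordinal lt_i); rewrite /= ltnSn.
  rewrite hs; apply/existsP/existsP => -[j /andP[lt_j bj]]; exists j.
    by rewrite bj andbT ltnW.
  rewrite bj andbT; move: lt_j; rewrite ltnS leq_eqVlt => /orP[/eqP e|//].
  by rewrite (_ : j = Ordinal lt_i) ?hb in bj; last exact: val_inj.
- move=> s [_ _ hs]; split=> [/eqP|[i hi]].
    by rewrite hs => /existsP[i /andP[_ hi]]; exists i.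
  by apply/eqP; rewrite hs; apply/existsP; exists i; rewrite ltn_ord.
by rewrite /=; lia.
Qed.

Theorem theorem1 (R : realType) :
  exists (p : cmd) (C : nat),
    forall I : instance R, valid I -> is_tree I ->
      exists (st : state R) (T : nat),
        [/\ exec p (load I) st T,
            (T <= C * (nv I + nag I * trunc_log 2 (nag I)))%N
          & answers_yes st <-> returning_delivery I].
Proof.
exists Decide, (100 * 100)%N => I validI treeI.
have [par [dep [wt [ch rootedI]]]] : exists par dep wt ch,
    @rooted R I (src I) par dep wt ch.
  by do 4 eexists; exact: rooted_tree.
have src_dst : src I != dst I by case: validI.
have geo := returning_deliveryP rootedI src_dst.
pose k := nag I; pose L := trunc_log 2 k; pose l := dist par dep wt (dst I).
pose x : 'I_k -> R := carrier_pos par dep wt.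
pose b : 'I_k -> R := carrier_range par dep wt.
suff [st [T [ex le_T q]]] : runs Decide (load I)
    (1000 * (nv I + k).+1 + (bcost (BLeR TwiceLength (RVar 10)) +
      (200 * k.+1 + (k * (update_cost k + 100) + 20 +
      ((2 * update_cost k + 300) * (2 * k + 2) + 40))) + 4))%N
    (fun st => answers_yes st <-> returning_delivery I).
  exists st, T; split=> //; apply: leq_trans le_T _; rewrite -/k -/L.
  have n0 : (0 < nv I)%N by case: (nv I) (src I) => // -[].
  (* For a single agent the logarithm is 0, and the vertex count absorbs it. *)
  have kL : (k <= nv I + k * L)%N.
    have [k2|] := ltnP 1 k; last by lia.
    have : (0 < L)%N by rewrite /L trunc_log_gt0.
    by nia.
  (* This absorbs the logarithmic cost of the constant number of extra updates in the greedy
     bound. *)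
  have LL : (L <= k * L)%N.
    by have [k0|k0] := posnP k; [rewrite /L k0|rewrite leq_pmull].
  by rewrite [bcost _]/= /update_cost -/L; nia.
apply: (runs_seq (runs_frame (runs_survey rootedI))) => s1 [[i1 ds cs] fr1].
have rs1 : ready x b s1.
  by split=> [|i]; [exact: input_k i1|apply: cs; exact: ltn_ord].
have n1 a j : (7 < a < 11)%N -> nmem s1 a j = 0%N.
  by case: a => [|[|[|[|[|[|[|[|[|[|[|a]]]]]]]]]]] // _;
    rewrite fr1.1 // load_nmem.
have r1 a j : (7 < a < 11)%N -> rmem s1 a j = 0.
  by case: a => [|[|[|[|[|[|[|[|[|[|[|a]]]]]]]]]]] // _;
    rewrite fr1.2 // load_rmem.
have lenE s ns rs : agree_outside ns rs s1 s -> 0%N \notin ns -> 3%N \notin rs ->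
    reval s TwiceLength = l + l.
  move=> fr h1 h2; rewrite /= !fr.1 // !fr.2 // (input_t i1).
  by have [-> _] := ds (dst I).
have len1 : reval s1 TwiceLength = l + l.
  by apply: (lenE s1 [::] [::]).
apply: (runs_seq (Q1 := fun s => nmem s 14 0 = 1%N <-> returning_delivery I)); last first.
  by move=> s yes; apply: runs_straight => //; rewrite /answers_yes /= /upd.
apply: runs_if.
rewrite -[beval _ _]/(reval s1 TwiceLength <= rmem s1 10 0) len1 r1 //.
move: geo; rewrite -/l -/x -/b; case: ifP => _ geo.
  apply: (runs_weaken (runs_any_range rs1 (r1 10 0 isT))); first by lia.
  by move=> s any; apply: iff_trans any (iff_sym geo).
apply: (runs_seq (runs_frame (runs_halve rs1))) => s2 [hs2 fr2].
have rs2 := ready_frame fr2 isT isT rs1.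
have z9 j : nmem s2 9 j = 0%N by rewrite fr2.1 // n1.
apply: (runs_seq (runs_frame (runs_fill rs2 hs2 z9))) => s3 [t3 fr3].
have rs3 := ready_frame fr3 isT isT rs2.
have hs3 : halves k (nmem s3 8) by move=> p lt_p; rewrite !fr3.1 //; apply: hs2.
have z10 j : nmem s3 10 j = 0%N by rewrite fr3.1 // fr2.1 // n1.
have z8 : rmem s3 8 0 = 0 by rewrite fr3.2 // fr2.2 // r1.
apply: (runs_seq (runs_frame (runs_greedy (l + l) rs3 hs3 t3 z10 z8))) => s4 [cov fr4].
have len4 : reval s4 TwiceLength = l + l.
  by apply: (lenE _ _ _ (agree_outside_trans fr2 (agree_outside_trans fr3 fr4))).
have vE : reval s4 TwiceLength <= rmem s4 8 0 <-> returning_delivery I.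
  by rewrite len4; apply: iff_sym; apply: iff_trans geo cov.
apply: runs_straight => //=.
rewrite -[_ <= _]/(reval s4 TwiceLength <= rmem s4 8 0).
by case: ifP vE => _ [h1 h2]; split=> // h; [exact: h1|have := h2 h].
Qed.
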